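(* Let $\mathcal C_k=\{S\subseteq\{1,\dots,d\}:|S|=k\}$, let $q\in L^2_\mu(\Omega)$ have positive variance, write $T_S:=T_S^{\rm closed}(q)$ and $T_{\max}:=\max_{S\in\mathcal C_k}T_S$, and let $\widehat T_S$ be empirical estimates of $T_S$, $S\in\mathcal C_k$. Let $\vartheta_{\rm Sob}\in(0,1)$ and $m_{\rm Sob}>0$, and suppose the target family $\mathcal A_{k,{\rm closed}}^{\rm gap}\subseteq\mathcal C_k$ is separated: $$T_S-\vartheta_{\rm Sob}T_{\max}\ge m_{\rm Sob}\ \ (S\in\mathcal A_{k,{\rm closed}}^{\rm gap}),\qquad T_S-\vartheta_{\rm Sob}T_{\max}\le-m_{\rm Sob}\ \ (S\in\mathcal C_k\setminus\mathcal A_{k,{\rm closed}}^{\rm gap}).$$ (i) If $\max_{S\in\mathcal C_k}|\widehat T_S-T_S|\le e_k<m_{\rm Sob}/(1+\vartheta_{\rm Sob})$, then $$\widehat{\mathcal A}_k:=\Bigl\{S\in\mathcal C_k:\widehat T_S>\vartheta_{\rm Sob}\max_{S'\in\mathcal C_k}\widehat T_{S'}\Bigr\}=\mathcal A_{k,{\rm closed}}^{\rm gap}.$$ (ii) Suppose $\|q\|_\infty\le G_\infty$ and $\operatorname{Var}(q)\ge v_{\min}>0$, and let $\widehat T_S$ be the Saltelli pick-freeze estimators based on $M_{\rm pf}$ independent pick-freeze rows. Then for $\eta\in(0,1)$ the event in (i) holds with probability at least $1-\eta$ provided $$M_{\rm pf}\gtrsim\frac{G_\infty^4(1+\vartheta_{\rm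 Sob})^2}{v_{\min}^2m_{\rm Sob}^2}\log\frac{2|\mathcal C_k|}{\eta},$$ with a universal implicit constant.
   Context: $\Omega=\prod_{i=1}^d\Omega_i$ carries the product probability measure $\mu=\otimes_i\mu_i$; expectations and variances are with respect to $\mu$. For $q\in L^2_\mu(\Omega)$ with $\operatorname{Var}(q)>0$ and $X\sim\mu$ with coordinate subvector $X_S$, the closed Sobol index is $T_S^{\rm closed}(q)=\operatorname{Var}(\mathbb E[q(X)\mid X_S])/\operatorname{Var}(q)$. Saltelli pick-freeze estimator: draw independent rows $(X_i,X_i')$, $1\le i\le M_{\rm pf}$, with $X_i,X_i'\sim\mu$ independent, and let $X_i^{S}$ be the hybrid point whose coordinates in $S$ are those of $X_i$ and whose remaining coordinates are those of $X_i'$. Then $\widehat T_S$ is the ratio of the empirical numerator $\frac1{M_{\rm pf}}\sum_i q(X_i)\bigl(q(X_i^S)-q(X_i')\bigr)$, an unbiased estimate of $\operatorname{Var}(\mathbb E[q\mid X_S])$, to the empirical variance of $q$ on the sample (the score being set to $0$ if the empirical variance vanishes). *)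

(* Defs.v *)
From HB Require Import structures.
From mathcomp Require Import all_boot all_order all_algebra.
From mathcomp Require Import all_classical all_reals all_analysis.

Set Implicit Arguments.
Unset Strict Implicit.
Unset Printing Implicit Defensive.

Import Order.TTheory GRing.Theory Num.Theory.
Import numFieldNormedType.Exports.

Local Open Scope classical_set_scope.
Local Open Scope ring_scope.

Section product_space.
Context (d : nat) (disp : 'I_d -> measure_display).
Variable T : forall i : 'I_d, measurableType (disp i).

Definition coord_sets (S : {set 'I_d}) : set (set (forall i, T i)) :=
  \bigcup_(i in [set` S])
    preimage_set_system setT (fun x : forall i, T i => x i) measurable.

(* The sigma-algebra sigma(X_S), X being the identity map of the product. *)
Definition coord_sigma (S : {set 'I_d}) : set (set (forall i, T i)) :=
  <<s coord_sets S >>.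

(* The product of the T i; its measurable sets are coord_sigma [set: 'I_d]. *)
Definition prod_space : Type :=
  g_sigma_algebraType (coord_sets [set: 'I_d]%SET).

HB.instance Definition _ := Measurable.on prod_space.

(* By the pi-lambda theorem these values on boxes determine mu. *)
Definition is_product_measure (R : realType)
    (mui : forall i, probability (T i) R) (mu : probability prod_space R) :=
  forall A : forall i, set (T i), (forall i, measurable (A i)) ->
    mu [set x : prod_space | forall i, A i (x i)] =
    (\prod_(i < d) mui i (A i))%E.

Definition hybrid (S : {set 'I_d}) (x x' : prod_space) : prod_space :=
  fun j => if j \in S then x j else x' j.

End product_space.

Arguments coord_sets {d disp} T S.
Arguments coord_sigma {d disp} T S.

Section conditional_expectation.
Local Open Scope ereal_scope.
Context (dT : measure_display) (T : measurableType dT) (R : realType).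
Variables (P : probability T R) (G : set (set T)) (f : T -> R).

Definition is_cond_exp (g : T -> R) : Prop :=
  [/\ forall B : set R, measurable B -> G (g @^-1` B),
      P.-integrable setT (EFin \o g) &
      forall A, G A -> \int[P]_(x in A) (g x)%:E = \int[P]_(x in A) (f x)%:E].

(* A version of E[f | G]; for f in L^2 it is unique up to P-null sets. *)
Definition cond_exp : T -> R := xget (cst 0%R) [set g | is_cond_exp g].

End conditional_expectation.

Definition mutually_independent (dW dE : measure_display)
    (W : measurableType dW) (E : measurableType dE) (R : realType)
    (P : probability W R) (I : finType) (Z : I -> W -> E) : Prop :=
  forall (J : {set I}) (A : I -> set E), (forall i, measurable (A i)) ->
    P (\bigcap_(i in [set` J]) (Z i @^-1` A i)) =
    (\prod_(i in J) P (Z i @^-1` A i))%E.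

(* The genuine maximum when C is nonempty, and 0 otherwise. *)
Definition max_over (R : realType) (I : finType) (C : {set I}) (f : I -> R) :
    R :=
  fine (\big[maxe/-oo%E]_(i in C) (f i)%:E).

Section sobol.
Context (d : nat) (disp : 'I_d -> measure_display).
Variable T : forall i : 'I_d, measurableType (disp i).
Variable R : realType.

Definition closed_sobol (mu : probability (prod_space T) R)
    (q : prod_space T -> R) (S : {set 'I_d}) : R :=
  fine 'V_mu[cond_exp mu (coord_sigma T S) q] / fine 'V_mu[q].

Definition pick_freeze_rows (dW : measure_display) (W : measurableType dW)
    (P : probability W R) (mu : probability (prod_space T) R) (M : nat)
    (X X' : 'I_M -> {mfun W >-> prod_space T}) : Prop :=
  [/\ forall i A, measurable A -> distribution P (X i) A = mu A,
      forall i A, measurable A -> distribution P (X' i) A = mu A &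
      mutually_independent P (fun s : 'I_M + 'I_M =>
        match s with inl i => X i : W -> _ | inr i => X' i : W -> _ end)].

Variables (q : prod_space T -> R) (M : nat) (x x' : 'I_M -> prod_space T).

Definition pick_freeze_num (S : {set 'I_d}) : R :=
  M%:R^-1 * \sum_(i < M) q (x i) * (q (hybrid S (x i) (x' i)) - q (x' i)).

Definition empirical_mean : R := M%:R^-1 * \sum_(i < M) q (x i).

Definition empirical_var : R :=
  M%:R^-1 * \sum_(i < M) (q (x i) - empirical_mean) ^+ 2.

Definition saltelli (S : {set 'I_d}) : R :=
  if empirical_var == 0 then 0 else pick_freeze_num S / empirical_var.

End sobol.

Definition subsets_of_card (d k : nat) : {set {set 'I_d}} :=
  [set S : {set 'I_d} | #|S| == k]%SET.

Definition threshold_select (R : realType) (I : finType) (C : {set I})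
    (theta : R) (f : I -> R) : {set I} :=
  [set S in C | theta * max_over C f < f S]%SET.

(* Main.v *)
Require Import Defs.
From HB Require Import structures.
From mathcomp Require Import all_boot all_order all_algebra.
From mathcomp Require Import all_classical all_reals all_analysis.
From mathcomp Require Import measurable_realfun ess_sup_inf.
From mathcomp Require Import ring lra.

Set Implicit Arguments.
Unset Strict Implicit.
Unset Printing Implicit Defensive.

Import Order.TTheory GRing.Theory Num.Theory.
Import numFieldNormedType.Exports.

Local Open Scope classical_set_scope.
Local Open Scope ring_scope.

(** Part (i) is a perturbation argument: an error of at most [e] on every score
    moves [T_S - theta * Tmax] by at most [(1 + theta) * e < m].

    For part (ii), [q] may be clipped to [[-G, G]], which changes it only on a
    null set.  The hybrid of two independent points of law [mu] has law [mu], so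
    [x |-> \int q (hybrid S x x') dmu(x')] is a version of [E[q | X_S]] and
    [Var (E[q | X_S]) = E[q(X) q(X^S)] - (E q)^2].  Hence the numerators, the
    empirical mean and the averages of [(q - E q)^2] are, up to centering, means
    of [M] independent variables bounded by a multiple of [G^2]; Chernoff's
    method and a union bound over [|C| + 2] such means give a deviation of at
    most [t = m * vmin / (12 * (1 + theta))] for all of them, outside an event
    of probability at most [2 (|C| + 2) exp (- M t^2 / (512 G^4)) <= eta].
    On the complement every ratio is within [6 t / Var q] of its target. *)

(** * Stability of the threshold selection *)

Section max_over.
Context (R : realType) (I : finType).
Implicit Types (C : {set I}) (f : I -> R).

(** The start value [-oo] is absorbed as soon as [C] has an element, so [fine] loses nothing and the
    maximum is attained at some index of [C]. *)
Lemma max_overP C f i0 : i0 \in C ->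
  exists2 i, i \in C & max_over C f = f i /\ forall j, j \in C -> f j <= f i.
Proof.
move=> i0C; case: (@arg_maxP _ _ _ i0 (mem C) f i0C) => i iC imax.
exists i => //; split; last by move=> j jC; exact: imax.
rewrite /max_over -[RHS]/(fine (f i)%:E); congr fine.
apply/eqP; rewrite eq_le; apply/andP; split.
  by apply: bigmax_le => [|j jC]; rewrite ?leNye// lee_fin; exact: imax.
exact: (@le_bigmax_cond _ _ _ -oo%E i (mem C) (fun i => (f i)%:E)).
Qed.

Lemma max_over_set0 f : max_over finset.set0 f = 0.
Proof. by rewrite /max_over big_set0. Qed.

Lemma le_max_over C f i : i \in C -> f i <= max_over C f.
Proof. by move=> iC; have [j _ [-> fj]] := max_overP f iC; exact: fj. Qed.

Lemma max_over_leP C f i0 e : i0 \in C ->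
  reflect (forall i, i \in C -> f i <= e) (max_over C f <= e).
Proof.
move=> i0C; apply: (iffP idP) => [fe i iC|fe].
  exact: le_trans (le_max_over f iC) fe.
by have [i iC [-> _]] := max_overP f i0C; exact: fe.
Qed.

Lemma threshold_select_stable C (A : {set I}) (theta m e : R) (f g : I -> R) :
  0 < theta -> A \subset C ->
  (forall i, i \in A -> m <= f i - theta * max_over C f) ->
  (forall i, i \in (C :\: A)%SET -> f i - theta * max_over C f <= - m) ->
  max_over C (fun i => `|g i - f i|) <= e -> e < m / (1 + theta) ->
  threshold_select C theta g = A.
Proof.
move=> theta0 /fintype.subsetP AC sepA sepCA ge em.
apply/setP => i; rewrite inE.
have [iC|iC] := boolP (i \in C); last first.
  by apply/esym/negbTE; apply: contra iC; exact: AC.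
have {}em : e * (1 + theta) < m by rewrite -ltr_pdivlMr// addr_gt0.
have {}ge j : j \in C -> `|g j - f j| <= e.
  by move: j; exact/(max_over_leP _ _ iC).
have [jf jfC [maxf lef]] := max_overP f iC.
have [jg jgC [maxg leg]] := max_overP g iC.
have /ler_normlP[] := ge _ iC.
have /ler_normlP[] := ge _ jfC.
have /ler_normlP[] := ge _ jgC.
have := lef _ jgC; have := leg _ jfC; rewrite maxg /=.
have [iA|iA] := boolP (i \in A).
  move: (sepA _ iA); rewrite maxf => *.
  (* The two scores may peak at different indices. An upper bound on the maximum of [g] comes from
     its own peak: [g jg <= f jg + e <= f jf + e]. *)
  have : theta * g jg <= theta * (f jf + e) by rewrite ler_pM2l//; lra.
  by move=> *; apply/idP; lra.
have := sepCA i; rewrite finset.in_setD iA iC maxf => /(_ isT) *.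
(* Here a lower bound is needed, and it comes from the peak of [f]: [f jf - e <= g jf <= g jg]. *)
have : theta * (f jf - e) <= theta * g jg by rewrite ler_pM2l//; lra.
by move=> *; apply/negbTE; rewrite -leNgt; lra.
Qed.

End max_over.

(** * Expectations of products over independent pairs *)

Section weighted_measure.
Local Open Scope ereal_scope.
Context d (T : measurableType d) (R : realType).
Variables (mu : {measure set T -> \bar R}) (F : T -> R).

(** The measure with density [F] with respect to [mu]. Measurability and nonnegativity of [F] are
    arguments, so that the measure structure can be attached to the term itself. *)
Definition weighted_measure of measurable_fun [set: T] F &
  (forall x, 0 <= F x)%R := fun D : set T => \int[mu]_(x in D) (F x)%:E.

Variables (mF : measurable_fun [set: T] F) (F0 : forall x, (0 <= F x)%R).
Local Notation nu := (weighted_measure mF F0).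

Let nu0 : nu set0 = 0.
Proof. exact: integral_set0. Qed.

Let nu_ge0 D : 0 <= nu D.
Proof. by apply: integral_ge0 => x _; rewrite lee_fin. Qed.

Let nu_sigma_additive : semi_sigma_additive nu.
Proof.
move=> A mA tA mUA; rewrite /weighted_measure ge0_integral_bigcup//.
- by apply: is_cvg_nneseries => n _ _; exact: nu_ge0.
- exact/measurable_EFinP/measurable_funTS.
- by move=> x _; rewrite lee_fin.
Qed.

HB.instance Definition _ :=
  isMeasure.Build _ _ _ nu nu0 nu_ge0 nu_sigma_additive.

Import HBNNSimple.

(** Simple functions increase to [f], and monotone convergence applies on both sides. By linearity
    only indicators remain, for which the identity is the definition of the weighted measure. *)
Lemma ge0_integral_weighted (f : T -> \bar R) :
  measurable_fun [set: T] f -> (forall x, 0 <= f x) ->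
  \int[nu]_x f x = \int[mu]_x ((F x)%:E * f x).
Proof.
move=> mf f0; pose f_ := nnsfun_approx measurableT mf.
have mFE : measurable_fun [set: T] (fun x => (F x)%:E).
  exact/measurable_EFinP.
have F0E x : 0 <= (F x)%:E by rewrite lee_fin.
have cvg_f x : (f_ n x)%:E @[n --> \oo] --> f x.
  by apply: (@cvg_nnsfun_approx _ _ _ _ measurableT _ mf) => // y _; exact: f0.
have ndf x : nondecreasing_seq (fun n => (f_ n x)%:E).
  by move=> m n mn; rewrite lee_fin; exact/lefP/nd_nnsfun_approx.
transitivity (limn (fun n => \int[nu]_x (f_ n x)%:E)).
  rewrite -monotone_convergence//.
  - by apply: eq_integral => x _; exact/esym/cvg_lim.
  - by move=> n; exact/measurable_EFinP/measurable_funP.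
  - by move=> n x _; rewrite lee_fin.
transitivity (limn (fun n => \int[mu]_x ((F x)%:E * (f_ n x)%:E))); last first.
  rewrite -monotone_convergence//.
  - by apply: eq_integral => x _; apply/cvg_lim => //; exact: cvgeZl.
  - by move=> n; apply: emeasurable_funM => //; exact/measurable_EFinP.
  - by move=> n x _; rewrite mule_ge0// lee_fin.
  - by move=> x _ m n mn; rewrite lee_wpmul2l//; exact: ndf.
apply/congr_lim/funext => n.
have mr r : measurable (f_ n @^-1` [set r]) by exact: measurable_funPTI.
transitivity (\sum_(r \in range (f_ n))
    \int[nu]_x (r * \1_(f_ n @^-1` [set r]) x)%:E).
  under eq_integral do rewrite fimfunE -fsumEFin//.
  rewrite ge0_integral_fsum//.
  - by move=> r; exact/measurable_EFinP/measurable_funM.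
  - by move=> r x _; rewrite nnfun_muleindic_ge0.
transitivity (\sum_(r \in range (f_ n))
    \int[mu]_x ((F x)%:E * (r * \1_(f_ n @^-1` [set r]) x)%:E)); last first.
  rewrite -ge0_integral_fsum//.
  - apply: eq_integral => x _; rewrite fimfunE -fsumEFin// ge0_mule_fsumr//.
    by move=> r; rewrite nnfun_muleindic_ge0.
  - move=> r; apply: emeasurable_funM => //.
    exact/measurable_EFinP/measurable_funM.
  - by move=> r x _; rewrite mule_ge0// nnfun_muleindic_ge0.
apply: eq_fsbigr => r /[!inE] -[y _ fyr].
have r0 : (0 <= r)%R by rewrite -fyr.
rewrite integralZl_indic_nnsfun// integral_indic// setIT.
under [RHS]eq_integral do rewrite EFinM muleCA.
rewrite [RHS]ge0_integralZl//; last 2 first.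
- by apply: emeasurable_funM => //; exact/measurable_EFinP/measurable_indic.
- by move=> x _; rewrite mule_ge0.
congr (_ * _); rewrite [LHS]integral_mkcond.
by apply: eq_integral => x _; rewrite epatch_indic.
Qed.

End weighted_measure.

Lemma measure_prod_unique d1 d2 (T1 : measurableType d1)
    (T2 : measurableType d2) (R : realType)
    (m m' : {measure set (T1 * T2) -> \bar R}) :
  (m setT < +oo)%E ->
  (forall A B, measurable A -> measurable B -> m (A `*` B) = m' (A `*` B)) ->
  forall X, measurable X -> m X = m' X.
Proof.
move=> moo mm'.
pose rect := [set A `*` B | A in @measurable _ T1 & B in @measurable _ T2].
apply: (@measure_unique _ _ _ rect (fun=> setT)).
- exact: measurable_prod_measurableType.
- move=> _ _ [A mA [B mB <-]] [A' mA' [B' mB' <-]]; rewrite -setXI.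
  exists (A `&` A'); first exact: measurableI.
  by exists (B `&` B') => //; exact: measurableI.
- by move=> _; exists setT => //; exists setT => //; rewrite setXTT.
- by rewrite bigcup_const.
- by move=> _ [A mA [B mB <-]]; exact: mm'.
- by move=> _.
Qed.

Section independent_pairs.
Local Open Scope ereal_scope.
Context d d1 d2 (W : measurableType d) (T1 : measurableType d1)
  (T2 : measurableType d2) (R : realType) (I : finType).
Variables (P : probability W R) (Q : probability (T1 * T2)%type R).
Variable Z : I -> W -> T1 * T2.
Hypothesis mZ : forall i, measurable_fun [set: W] (Z i).
(** Independence is required on rectangles only. Taking all sides but those of one index to be full
    shows that each [Z i] has the values of [Q] on rectangles. *)
Hypothesis indepZ : forall (A : I -> set T1) (B : I -> set T2),
  (forall i, measurable (A i)) -> (forall i, measurable (B i)) ->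
  P [set w | forall i, (A i `*` B i) (Z i w)] = \prod_i Q (A i `*` B i).

Let indic_prod (D : I -> set (T1 * T2)) w :
  (\prod_i \1_(D i) (Z i w) = \1_[set w | forall i, D i (Z i w)] w :> R)%R.
Proof.
rewrite [RHS]indicE; case: (boolP (w \in _)) => [|/negP]; rewrite inE /= => Dw.
  by rewrite big1// => i _; rewrite indicE mem_set.
have [i /= Di] : exists i, ~ D i (Z i w) by exact/existsNP.
by apply/eqP/prodf_eq0; exists i => //; rewrite indicE memNset.
Qed.

(* Functions outside [K] are indicators of rectangles; the rectangles are
   replaced by arbitrary functions one index at a time. *)
Let expectation_prod_partial (K : {set I}) (f : I -> T1 * T2 -> R) (b : R) :
  (forall i, measurable_fun [set: T1 * T2] (f i)) ->
  (forall i z, 0 <= f i z <= b)%R ->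
  (forall i, i \notin K ->
    exists2 A, measurable A & exists2 B, measurable B & f i = \1_(A `*` B)) ->
  \int[P]_w (\prod_i f i (Z i w))%:E = \prod_i \int[Q]_z (f i z)%:E.
Proof.
move: {2}#|K| (leqnn #|K|) => n.
elim: n K f b => [|n IH] K f b Kn mf f0 fK.
  have {}fK i : exists D : set T1 * set T2,
      [/\ measurable D.1, measurable D.2 & f i = \1_(D.1 `*` D.2)].
    have /fK[A mA [B mB fi]] : i \notin K.
      by move: Kn; rewrite leqn0 cards_eq0 => /eqP ->; rewrite inE.
    by exists (A, B).
  have [D /all_and3[mD1 mD2 fD]] := choice fK.
  transitivity (P [set w | forall i, ((D i).1 `*` (D i).2) (Z i w)]).
    under eq_integral do under eq_bigr do rewrite fD.
    under eq_integral do rewrite indic_prod.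
    rewrite integral_indic ?setIT//.
    rewrite (_ : mkset _ =
        \bigcap_(i in [set: I]) (Z i @^-1` ((D i).1 `*` (D i).2))).
      apply: fin_bigcap_measurable => // i _; rewrite -[X in measurable X]setTI.
      by apply: mZ => //; exact: measurableX.
    by apply/seteqP; split => w /= h i => [_|]; exact: h.
  rewrite indepZ//; apply: eq_bigr => i _.
  have mD := measurableX (mD1 i) (mD2 i).
  by rewrite fD integral_indic// setIT.
have [K0|/set0Pn[j jK]] := eqVneq K finset.set0.
  by subst K; apply: (IH finset.set0 f b) => //; rewrite cards0.
(* The factor at [j] is released by comparing two measures: [nu], the image under [Z j] of [P]
   weighted by the other factors, and [nu'], which is [Q] scaled by the product [c] of the other
   integrals. On a rectangle the factor at [j] is an indicator, so the induction hypothesis gives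
   their equality there; rectangles determine both measures, and integrating [f j] against them
   gives the claim. *)
pose F w := (\prod_(i | i != j) f i (Z i w))%R.
have mfZ i : measurable_fun [set: W] (fun w => f i (Z i w)).
  exact: measurableT_comp.
have mF : measurable_fun [set: W] F.
  by rewrite /F; under eq_fun do rewrite -big_filter; exact: measurable_prod.
have f_ge0 i z : (0 <= f i z)%R by have /andP[] := f0 i z.
have F0 w : (0 <= F w)%R by exact: prodr_ge0.
pose c := (\prod_(i | i != j) \int[Q]_z f i z)%R.
have c0 : (0 <= c)%R.
  by apply: prodr_ge0 => i _; exact: Rintegral_ge0.
have intf i : Q.-integrable [set: T1 * T2] (EFin \o f i).
  apply: measurable_bounded_integrable => //.
    by rewrite ltey_eq fin_num_measure.
  exists b; split; first exact: num_real.
  move=> x bx z _ /=; rewrite ger0_norm//.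
  by have /andP[_ /le_trans] := f0 i z; apply; exact: ltW.
have cE : \prod_(i | i != j) \int[Q]_z (f i z)%:E = c%:E.
  rewrite /c -prodEFin; apply: eq_bigr => i _.
  rewrite /Rintegral fineK//; exact: integrable_fin_num (intf i).
pose nu := pushforward (weighted_measure P mF F0) (Z j).
pose nu' := mscale (NngNum c0) Q.
have nuE X : measurable X -> nu' X = nu X.
  move: X; apply: measure_prod_unique => [|A B mA mB].
    suff : c%:E * Q [set: T1 * T2] < +oo by [].
    by rewrite probability_setT mule1 ltry.
  suff : c%:E * Q (A `*` B) = nu (A `*` B) by [].
  rewrite -cE.
  have -> : Q (A `*` B) = \int[Q]_z (\1_(A `*` B) z)%:E.
    by rewrite integral_indic ?setIT//; exact: measurableX.
  pose g i := if i == j then \1_(A `*` B) else f i.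
  have gj : g j = \1_(A `*` B) by rewrite /g eqxx.
  have gNj i : i != j -> g i = f i by rewrite /g => /negbTE ->.
  transitivity (\prod_i \int[Q]_z (g i z)%:E).
    rewrite [RHS](bigD1 j)//= gj muleC; congr (_ * _).
    by apply: eq_bigr => i ij; rewrite gNj.
  (* The indicator now standing at [j] may exceed [b], whence the bound [Num.max b 1]. *)
  rewrite -(IH (K :\ j)%SET g (Num.max b 1%R)).
  - rewrite /nu /pushforward /weighted_measure integral_mkcond.
    apply: eq_integral => w _; rewrite (bigD1 j)//= gj epatch_indic/=.
    by rewrite EFinM [RHS]muleC; congr (_ * _%:E); apply: eq_bigr => i /gNj ->.
  - by move: Kn; rewrite (cardsD1 j K) jK.
  - move=> i; rewrite /g; case: ifP => // _.
    by apply: measurable_indic; exact: measurableX.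
  - move=> i z; rewrite /g; case: ifP => _.
      by rewrite indicE le_max; case: (_ \in _); rewrite ?lexx ?ler01 ?orbT.
    by rewrite f_ge0/= le_max; have /andP[_ ->] := f0 i z.
  - move=> i; rewrite !inE negb_and negbK => /orP[/eqP ->|iK].
      by exists A => //; exists B.
    rewrite /g; case: ifP => _; last exact: fK.
    by exists A => //; exists B.
rewrite (bigD1 j)//= cE.
transitivity (\int[nu]_z (f j z)%:E).
  rewrite ge0_integral_pushforward//; last 2 first.
  - exact/measurable_EFinP.
  - by move=> z _; rewrite lee_fin.
  rewrite preimage_setT ge0_integral_weighted//; last first.
  - by move=> w; rewrite lee_fin.
  - exact/measurable_EFinP.
  apply: eq_integral => w _ /=.
  by rewrite (bigD1 j)//= EFinM muleC.
transitivity (\int[nu']_z (f j z)%:E).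
  by apply: eq_measure_integral => A mA _; exact/esym/nuE.
rewrite ge0_integral_mscale//=; first by rewrite muleC.
- exact/measurable_EFinP.
- by move=> z _; rewrite lee_fin.
Qed.

Lemma expectation_prod_independent (f : I -> T1 * T2 -> R) (b : R) :
  (forall i, measurable_fun [set: T1 * T2] (f i)) ->
  (forall i z, 0 <= f i z <= b)%R ->
  \int[P]_w (\prod_i f i (Z i w))%:E = \prod_i \int[Q]_z (f i z)%:E.
Proof.
move=> mf f0; apply: (@expectation_prod_partial [set: I]%SET f b) => // i.
by rewrite inE.
Qed.

End independent_pairs.

(** * Concentration of sums *)

Section chernoff.
Context (R : realType).

(** From [1 - x <= expR (- x)] one gets [expR x <= (1 - x)^-1], and the quadratic times [1 - x]
    equals [1 + x ^+ 2 * (1 - 2 * x)], which is at least [1]. *)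
Lemma expR_le_quadratic (x : R) : x <= 1 / 2 -> expR x <= 1 + x + 2 * x ^+ 2.
Proof.
move=> x2; have x1 : 0 < 1 - x by lra.
have : expR x <= (1 - x)^-1.
  rewrite -[expR x]invrK -expRN lef_pV2 ?posrE ?expR_gt0//.
  exact: expR_ge1Dx.
move=> /le_trans; apply.
rewrite -[leLHS]mul1r ler_pdivrMr//.
have : 0 <= x ^+ 2 * (1 - 2 * x) by apply: mulr_ge0; [exact: sqr_ge0|lra].
lra.
Qed.

Context d (E : measurableType d) (Q : probability E R).

Lemma bounded_integrable (f : E -> R) (B : R) :
  measurable_fun [set: E] f -> (forall z, `|f z| <= B) ->
  Q.-integrable [set: E] (EFin \o f).
Proof.
move=> mf fB; apply: measurable_bounded_integrable => //.
  by rewrite ltey_eq fin_num_measure.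
exists B; split; first exact: num_real.
by move=> x bx z _ /=; apply: le_trans (fB z) (ltW bx).
Qed.

(** The quadratic bound is integrated at [lambda * f z]: the linear term vanishes because [f] is
    centered, and [1 + u <= expR u] restores an exponential. *)
Lemma mgf_le (f : E -> R) (B lambda : R) :
  measurable_fun [set: E] f -> (forall z, `|f z| <= B) ->
  \int[Q]_z f z = 0 -> 0 <= lambda -> lambda * B <= 1 / 2 ->
  (\int[Q]_z (expR (lambda * f z))%:E <= (expR (2 * (lambda * B) ^+ 2))%:E)%E.
Proof.
move=> mf fB f0 l0 lB.
have intf := bounded_integrable mf fB.
have lf z : `|lambda * f z| <= lambda * B.
  by rewrite normrM (ger0_norm l0) ler_wpM2l.
apply: (@le_trans _ _
  (\int[Q]_z (1 + 2 * (lambda * B) ^+ 2 + lambda * f z)%:E)%E).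
  apply: ge0_le_integral => //=.
  - apply/measurable_EFinP; apply: measurableT_comp => //.
    exact: measurable_funM.
  - by apply/measurable_EFinP/measurable_funD => //; exact: measurable_funM.
  - move=> z _; rewrite lee_fin; have /ler_normlP[h1 h2] := lf z.
    apply: le_trans (expR_le_quadratic _) _; first by lra.
    rewrite addrAC lerD2r lerD2l ler_pM2l// -[leLHS]real_normK ?num_real//.
    by rewrite ler_sqr ?nnegrE//; exact: le_trans (lf z).
under eq_integral do rewrite EFinD EFinM.
rewrite integralD//=; last 2 first.
- exact: finite_measure_integrable_cst.
- exact: integrableZl.
rewrite integralZl//= integral_cst//= probability_setT mule1.
have -> : (\int[Q]_z (f z)%:E = 0)%E.
  rewrite -[LHS]fineK ?[fine _]f0//; exact: integrable_fin_num intf.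
by rewrite mule0 adde0 lee_fin expR_ge1Dx.
Qed.

End chernoff.

Section concentration.
Context (R : realType) d d1 d2 (W : measurableType d) (T1 : measurableType d1)
  (T2 : measurableType d2).
Variables (P : probability W R) (Q : probability (T1 * T2)%type R) (M : nat).
Variable Z : 'I_M -> W -> T1 * T2.
Hypothesis mZ : forall i, measurable_fun [set: W] (Z i).
Hypothesis indepZ : forall (A : 'I_M -> set T1) (B : 'I_M -> set T2),
  (forall i, measurable (A i)) -> (forall i, measurable (B i)) ->
  P [set w | forall i, (A i `*` B i) (Z i w)] = (\prod_i Q (A i `*` B i))%E.

Let measurable_sum_comp (f : T1 * T2 -> R) :
  measurable_fun [set: T1 * T2] f ->
  measurable_fun [set: W] (fun w => \sum_i f (Z i w)).
Proof. by move=> mf; apply: measurable_sum => i; exact: measurableT_comp. Qed.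

Lemma sum_upper_tail (f : T1 * T2 -> R) (B t : R) :
  measurable_fun [set: T1 * T2] f -> (forall z, `|f z| <= B) ->
  \int[Q]_z f z = 0 -> 0 < t <= 2 * B ->
  (P [set w | (M%:R * t <= \sum_i f (Z i w))%R] <=
   (expR (- (M%:R * t ^+ 2 / (8 * B ^+ 2))))%:E)%E.
Proof.
move=> mf fB f0 /andP[t0 tB]; have B0 : 0 < B by lra.
(* This value minimizes the exponent [- lambda * t + 2 * (lambda * B) ^+ 2] per summand, with
   minimum [- t ^+ 2 / (8 * B ^+ 2)]. The hypothesis [t <= 2 * B] is exactly
   [lambda * B <= 1 / 2]. *)
pose lambda := t / (4 * B ^+ 2).
have lB : lambda * B = t / (4 * B) by rewrite /lambda; field; lra.
have l0 : 0 < lambda by rewrite divr_gt0// mulr_gt0// exprn_gt0.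
pose S := [the {mfun W >-> R} of mfun_Sub (mem_set (measurable_sum_comp mf))].
have /le_trans := @chernoff _ _ _ P S _ (M%:R * t) l0; apply.
have {}mgf : ('M_P S lambda <= (expR (M%:R * (2 * (lambda * B) ^+ 2)))%:E)%E.
  rewrite /mmt_gen_fun unlock.
  under eq_integral => w _ do
    rewrite /= mulrC mulr_sumr expR_sum.
  have lf z : `|lambda * f z| <= lambda * B.
    by rewrite normrM (gtr0_norm l0) ler_wpM2l// ltW.
  (* Independence factors the moment generating function of the sum into [M] equal integrals over
     [Q]. *)
  rewrite (@expectation_prod_independent _ _ _ _ _ _ _ _ P Q Z mZ indepZ
    (fun _ z => expR (lambda * f z)) (expR (lambda * B))); first last.
  - move=> _ z; rewrite expR_ge0/= ler_expR.
    by have /ler_normlP[] := lf z; lra.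
  - by move=> _; apply: measurableT_comp => //; exact: measurable_funM.
  have mexp : measurable_fun [set: T1 * T2] (fun z => expR (lambda * f z)).
    by apply: measurableT_comp => //; exact: measurable_funM.
  have intexp : Q.-integrable [set: T1 * T2]
      (EFin \o (fun z => expR (lambda * f z))).
    apply: (@bounded_integrable _ _ _ _ _ (expR (lambda * B))) => // z.
    by rewrite ger0_norm ?expR_ge0// ler_expR; have /ler_normlP[] := lf z; lra.
  pose c := \int[Q]_z expR (lambda * f z).
  have cE : (\int[Q]_z (expR (lambda * f z))%:E = c%:E)%E.
    by rewrite /c /Rintegral fineK//; exact: integrable_fin_num intexp.
  have c0 : 0 <= c by apply: Rintegral_ge0 => z _; exact: expR_ge0.
  have cexp : c <= expR (2 * (lambda * B) ^+ 2).
    rewrite -lee_fin -cE; apply: mgf_le => //; first exact: ltW.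
    by rewrite lB ler_pdivrMr; lra.
  under eq_bigr do rewrite cE.
  rewrite prodEFin lee_fin prodr_const card_ord expRM_natl.
  by rewrite lerXn2r ?nnegrE ?expR_ge0.
apply: le_trans (lee_wpmul2r _ mgf) _; first by rewrite lee_fin expR_ge0.
rewrite -EFinM lee_fin -expRD ler_expR lB -subr_ge0 le_eqVlt; apply/orP; left.
rewrite eq_sym; apply/eqP; rewrite /lambda; field; lra.
Qed.

(** Union bound: each index costs two one-sided tails, those of [f j] and of its opposite.
    Measurability of the bad event goes through the same induction because subadditivity needs
    it. *)
Lemma sums_concentration (J : Type) (s : seq J) (f : J -> T1 * T2 -> R)
    (B t : R) :
  (forall j, measurable_fun [set: T1 * T2] (f j)) ->
  (forall j z, `|f j z| <= B) ->
  (forall j, \int[Q]_z f j z = 0) -> 0 < t <= 2 * B ->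
  let bad := [set w | has (fun j => M%:R * t <= `|\sum_i f j (Z i w)|) s] in
  measurable bad /\
  (P bad <= (2 * (size s)%:R * expR (- (M%:R * t ^+ 2 / (8 * B ^+ 2))))%:E)%E.
Proof.
move=> mf fB f0 tB /=.
set p := expR _.
have mS j : measurable [set w | M%:R * t <= \sum_i f j (Z i w)].
  rewrite -[X in measurable X]setTI; apply: measurable_fun_ler => //.
  exact: measurable_sum_comp.
have mS' j : measurable [set w | M%:R * t <= \sum_i - f j (Z i w)].
  rewrite -[X in measurable X]setTI; apply: measurable_fun_ler => //.
  by apply: (@measurable_sum_comp (fun z => - f j z)); exact: measurable_funN.
elim: s => [|j s [mbad IH]].
  rewrite [mkset _](_ : _ = set0); last by apply/seteqP; split.
  by split; rewrite ?measure0// mulr0 mul0r.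
have -> : [set w | has (fun j => M%:R * t <= `|\sum_i f j (Z i w)|) (j :: s)] =
   [set w | M%:R * t <= \sum_i f j (Z i w)] `|`
   [set w | M%:R * t <= \sum_i - f j (Z i w)] `|`
   [set w | has (fun j => M%:R * t <= `|\sum_i f j (Z i w)|) s].
  apply/seteqP; split => w /=; rewrite sumrN.
    case/orP => [|ws]; last by right.
    by rewrite ler_normr => /orP[]; [left; left|left; right].
  by rewrite ler_normr => -[[] ->|->]; rewrite ?orbT.
have mU := measurableU _ _ (mS j) (mS' j).
split; first exact: measurableU.
apply: le_trans (measureU2 _ _ _) _ => //.
apply: le_trans (leeD (measureU2 _ _ _) IH) _ => //.
apply: (@le_trans _ _ (p%:E + p%:E + (2 * (size s)%:R * p)%:E)%E).
  apply: leeD => //; apply: leeD; first exact: (@sum_upper_tail (f j)).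
  apply: (@sum_upper_tail (fun z => - f j z)) => //.
  - exact: measurable_funN.
  - by move=> z; rewrite normrN.
  - under eq_Rintegral do rewrite -mulN1r.
    rewrite RintegralZl ?f0 ?mulr0//; exact: bounded_integrable (fB j).
rewrite -!EFinD lee_fin /= -[(size s).+1%:R]natr1; lra.
Qed.

End concentration.

(** * Products of probability spaces and hybrid points *)

Section product_space_theory.
Context (d : nat) (disp : 'I_d -> measure_display).
Variable T : forall i : 'I_d, measurableType (disp i).
Implicit Types S : {set 'I_d}.

Definition box (A : forall i, set (T i)) : set (prod_space T) :=
  [set x | forall i, A i (x i)].

Lemma measurable_prod_spaceP dW (W : measurableType dW)
    (f : W -> prod_space T) :
  (forall i, measurable_fun [set: W] (fun w => f w i)) ->
  measurable_fun [set: W] f.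
Proof.
move=> mf; apply: (@measurability _ _ W (prod_space T) setT f
  (coord_sets T [set: 'I_d]%SET)) => //.
move=> _ [_ [i _] [A mA <-]] <-; rewrite !setTI.
by rewrite -[X in measurable X]setTI; exact: (mf i).
Qed.

Lemma measurable_coord S i : i \in S ->
  measurable_fun [set: g_sigma_algebraType (coord_sets T S)]
    (fun x : forall i, T i => x i).
Proof.
by move=> iS _ A mA; apply: sub_sigma_algebra; exists i => //; exists A.
Qed.

(** Measurability for [sigma(X_S)] alone: a measurable function that ignores the coordinates outside
    [S] factors through this map, hence is [sigma(X_S)]-measurable. *)
Lemma measurable_hybrid_fixed S (x0 : prod_space T) :
  measurable_fun [set: g_sigma_algebraType (coord_sets T S)]
    (fun x => hybrid S x x0 : prod_space T).
Proof.
apply: measurable_prod_spaceP => i; rewrite /hybrid.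
by have [iS|_] := boolP (i \in S);
  [exact: measurable_coord|exact: measurable_cst].
Qed.

Lemma measurable_prod_space_coord i :
  measurable_fun [set: prod_space T] (fun x : prod_space T => x i).
Proof. by apply: measurable_coord; rewrite finset.in_setT. Qed.

Lemma measurable_hybrid S :
  measurable_fun [set: prod_space T * prod_space T]
    (fun z => hybrid S z.1 z.2 : prod_space T).
Proof.
apply: measurable_prod_spaceP => i; rewrite /hybrid.
by have [_|_] := boolP (i \in S);
  apply: (measurableT_comp (@measurable_prod_space_coord i)).
Qed.

Lemma measurable_box (A : forall i, set (T i)) :
  (forall i, measurable (A i)) -> measurable (box A).
Proof.
move=> mA; rewrite (_ : box A = \bigcap_(i in [set: 'I_d])
    ((fun x : prod_space T => x i) @^-1` A i)).
  apply: fin_bigcap_measurable => // i _; rewrite -[X in measurable X]setTI.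
  exact: measurable_prod_space_coord.
by apply/seteqP; split => x /= xA i => [_|]; exact: xA.
Qed.

Lemma coord_sigma_measurable S (A : set (prod_space T)) :
  coord_sigma T S A -> measurable A.
Proof.
move: A; apply: smallest_sub; first exact: sigma_algebra_measurable.
by move=> A [i _ Ai]; apply: sub_sigma_algebra; exists i => //=; rewrite inE.
Qed.

(** The sets unaffected by overwriting the coordinates outside [S] with those of [x'] form a
    sigma-algebra that contains the generators of [sigma(X_S)]. *)
Lemma coord_sigma_hybrid S (A : set (prod_space T)) x x' :
  coord_sigma T S A -> A (hybrid S x x') = A x.
Proof.
move=> SA; pose inv := [set A : set (prod_space T) | A \o (hybrid S ^~ x') = A].
suff : inv A by move=> /(congr1 (@^~ x)).
move: A SA; apply: smallest_sub => [|_ [i iS] [A mA <-]].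
  split => [|A invA|A_ invA].
  - by apply/funext.
  - by apply/funext => y; rewrite /= /setD /mkset -[in RHS]invA.
  - apply/funext => y; apply/propext; split=> -[n _ An];
      exists n => //; have /(congr1 (@^~ y)) /= Ey := invA n.
      by rewrite -Ey.
    by rewrite /= Ey.
rewrite setTI; apply/funext => y; rewrite /comp /preimage /hybrid /mkset /=.
by rewrite ifT.
Qed.

Lemma boxI (A B : forall i, set (T i)) :
  box A `&` box B = box (fun i => A i `&` B i).
Proof.
apply/seteqP; split => x; first by case=> xA xB i; split.
by move=> xAB; split=> i; case: (xAB i).
Qed.

Lemma measure_box_unique (R : realType)
    (m m' : {measure set (prod_space T) -> \bar R}) :
  (m setT < +oo)%E ->
  (forall A : forall i, set (T i), (forall i, measurable (A i)) ->
    m (box A) = m' (box A)) ->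
  forall X, measurable X -> m X = m' X.
Proof.
move=> moo mm'.
pose boxes := [set B : set (prod_space T) |
  exists2 A : forall i, set (T i), (forall i, measurable (A i)) & B = box A].
apply: (@measure_unique _ _ _ boxes (fun=> setT)).
- apply/seteqP; split; apply: smallest_sub.
  + exact: smallest_sigma_algebra.
  + move=> _ [i _] [A mA <-]; apply: sub_sigma_algebra.
    (* A cylinder over coordinate [i] is the box whose other sides are full, so boxes generate the
       sigma-algebra. *)
    exists (@eqtype.dfwith _ (fun j => set (T j)) (fun=> setT) i A) => [j|].
      by case: eqtype.dfwithP.
    apply/seteqP; split => x; rewrite setTI /preimage /= => Ax.
      by move=> j; case: eqtype.dfwithP.
    by have := Ax i; rewrite eqtype.dfwith_in.
  + exact: sigma_algebra_measurable.
  + by move=> _ [A mA ->]; exact: measurable_box.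
- move=> _ _ [A mA ->] [B mB ->]; rewrite boxI.
  by exists (fun i => A i `&` B i) => // i; exact: measurableI.
- move=> _; exists (fun=> setT) => //.
  by apply/esym/seteqP; split.
- by rewrite bigcup_const.
- by move=> _ [A mA ->]; exact: mm'.
- by move=> _.
Qed.

End product_space_theory.

Section hybrid_law.
Context (d : nat) (disp : 'I_d -> measure_display).
Variable T : forall i : 'I_d, measurableType (disp i).
Context (R : realType) (mui : forall i, probability (T i) R).
Variable mu : probability (prod_space T) R.
Hypothesis mu_prod : is_product_measure mui mu.
Implicit Types S : {set 'I_d}.

Local Notation Q := (mu \x mu)%E.

(** A box pulls back to a rectangle of two boxes: the sides in [S] constrain the first point, the
    remaining sides the second, and all others are full. The product formula then agrees side by
    side, and boxes determine the law. *)
Lemma hybrid_law S (X : set (prod_space T)) : measurable X ->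
  pushforward Q (fun z => hybrid S z.1 z.2) X = mu X.
Proof.
move=> mX; apply/esym; move: X mX.
pose h := [the {mfun (prod_space T * prod_space T)%type >-> prod_space T} of
  mfun_Sub (mem_set (@measurable_hybrid _ _ T S))].
apply: (@measure_box_unique _ _ _ _ mu (pushforward Q h)) => [|A mA].
  by rewrite ltey_eq fin_num_measure.
pose A1 i := if i \in S then A i else setT.
pose A2 i := if i \in S then setT else A i.
have mA1 i : measurable (A1 i) by rewrite /A1; case: ifP.
have mA2 i : measurable (A2 i) by rewrite /A2; case: ifP.
have hE : h @^-1` box A = box A1 `*` box A2.
  apply/seteqP; split => [[x x'] /= hA|[x x'] /= [xA1 xA2] i].
    by split => i; rewrite /A1 /A2; have := hA i; rewrite /hybrid; case: ifP.
  by have := xA1 i; have := xA2 i; rewrite /A1 /A2 /hybrid; case: ifP.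
suff : mu (box A) = Q (box A1 `*` box A2) by rewrite -hE.
transitivity (mu (box A1) * mu (box A2))%E; last first.
    by apply/esym/product_measure1E; exact: measurable_box.
  rewrite [mu (box A)]mu_prod// [mu (box A1)]mu_prod// [mu (box A2)]mu_prod//.
  rewrite -big_split; apply: eq_bigr => i _ /=; rewrite /A1 /A2.
  by case: ifP; rewrite probability_setT ?mule1 ?mul1e.
Qed.

Lemma Rintegral_hybrid S (f : prod_space T -> R) (B : R) :
  measurable_fun [set: prod_space T] f -> (forall x, `|f x| <= B) ->
  \int[Q]_z f (hybrid S z.1 z.2) = \int[mu]_x f x.
Proof.
move=> mf fB; congr fine; have mh := @measurable_hybrid _ _ T S.
pose h := [the {mfun (prod_space T * prod_space T)%type >-> prod_space T} of
  mfun_Sub (mem_set mh)].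
transitivity (\int[pushforward Q h]_x (f x)%:E)%E.
  rewrite integral_pushforward//; first exact/measurable_EFinP.
  apply: (@bounded_integrable _ _ _ Q
    (f \o (fun z => hybrid S z.1 z.2)) B) => //.
  - exact: measurableT_comp.
  - by move=> z; exact: fB.
apply: (@eq_measure_integral _ _ _ _ mu (pushforward Q h)) => A mA _; exact:
  (hybrid_law S mA).
Qed.

End hybrid_law.

Section Rintegral_product.
Context d1 d2 (T1 : measurableType d1) (T2 : measurableType d2) (R : realType).
Variables (m1 : probability T1 R) (m2 : probability T2 R).
Variables (f : T1 * T2 -> R) (B : R).
Hypotheses (mf : measurable_fun [set: T1 * T2] f) (fB : forall z, `|f z| <= B).

Lemma measurable_section x : measurable_fun [set: T2] (fun y => f (x, y)).
Proof. exact: measurableT_comp. Qed.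

Let sectionE x : (\int[m2]_y (f (x, y))%:E)%E = (\int[m2]_y f (x, y))%:E.
Proof.
rewrite /Rintegral fineK//; apply: integrable_fin_num => //.
exact: (bounded_integrable _ (measurable_section x) (fun y => fB (x, y))).
Qed.

Let intf : (m1 \x m2)%E.-integrable [set: T1 * T2] (EFin \o f).
Proof. exact: (bounded_integrable _ mf fB). Qed.

Lemma measurable_Rintegral_section :
  measurable_fun [set: T1] (fun x => \int[m2]_y f (x, y)).
Proof.
apply/measurable_EFinP; have := @measurable_fubini_F _ _ _ _ _ m1 m2 _ intf.
by apply: eq_measurable_fun => x _; exact: sectionE.
Qed.

Lemma Rintegral_prod :
  \int[(m1 \x m2)%E]_z f z = \int[m1]_x \int[m2]_y f (x, y).
Proof.
congr fine; rewrite -integral12_prod_meas1//.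
by apply: eq_integral => x _; exact: sectionE.
Qed.

End Rintegral_product.

(** * Conditional expectations and Sobol indices *)

Section bounded_Rintegral.
Context d (T : measurableType d) (R : realType) (m : probability T R).
Implicit Types (f g : T -> R).

Lemma bounded_RintegralD f g (B C : R) :
  measurable_fun [set: T] f -> measurable_fun [set: T] g ->
  (forall x, `|f x| <= B) -> (forall x, `|g x| <= C) ->
  \int[m]_x (f x + g x) = \int[m]_x f x + \int[m]_x g x.
Proof.
by move=> mf mg fB gC; rewrite RintegralD//;
  [exact: bounded_integrable fB|exact: bounded_integrable gC].
Qed.

Lemma bounded_RintegralZl f (B c : R) :
  measurable_fun [set: T] f -> (forall x, `|f x| <= B) ->
  \int[m]_x (c * f x) = c * \int[m]_x f x.
Proof.
by move=> mf fB; rewrite RintegralZl//; exact: bounded_integrable fB.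
Qed.

Lemma Rintegral_cst_probability (c : R) : \int[m]_x c = c.
Proof.
rewrite Rintegral_cst// (_ : fine _ = 1) ?mulr1//.
exact: (congr1 fine (probability_setT m)).
Qed.

Lemma integral_indicM f (B : R) (A : set T) :
  measurable A -> measurable_fun [set: T] f -> (forall x, `|f x| <= B) ->
  (\int[m]_(x in A) (f x)%:E)%E = (\int[m]_x (f x * \1_A x))%:E.
Proof.
move=> mA mf fB; rewrite /Rintegral fineK.
  rewrite [LHS]integral_mkcond.
  by apply: eq_integral => x _; rewrite epatch_indic.
apply: integrable_fin_num => //.
apply: (@bounded_integrable _ _ _ m (fun x => f x * \1_A x) B) => [|x].
  exact: measurable_funM.
rewrite normrM -[leRHS]mulr1 ler_pM// indicE.
by case: (_ \in _); rewrite ?normr1 ?normr0.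
Qed.

Lemma varianceE_bounded f (B : R) :
  measurable_fun [set: T] f -> (forall x, `|f x| <= B) ->
  fine 'V_m[f] = \int[m]_x (f x - \int[m]_y f y) ^+ 2 /\
  fine 'V_m[f] = \int[m]_x (f x ^+ 2) - (\int[m]_x f x) ^+ 2.
Proof.
move=> mf fB; set c := \int[m]_y f y.
have E1 : fine 'V_m[f] = \int[m]_x (f x - c) ^+ 2.
  by rewrite /variance unlock unlock.
split=> //; rewrite E1.
have -> : \int[m]_x (f x - c) ^+ 2 =
    \int[m]_x (f x ^+ 2 + (c ^+ 2 + - (2 * c) * f x)).
  by apply: eq_Rintegral => x _; ring.
have mf2 : measurable_fun [set: T] (fun x => f x ^+ 2).
  exact: measurable_funX.
have f2B x : `|f x ^+ 2| <= B ^+ 2.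
  by rewrite normrX lerXn2r// nnegrE// (le_trans _ (fB x)).
have mcf : measurable_fun [set: T] (fun x => - (2 * c) * f x).
  exact: measurable_funM.
have cfB x : `|- (2 * c) * f x| <= `|2 * c| * B.
  by rewrite normrM normrN ler_wpM2l.
rewrite (@bounded_RintegralD (fun x => f x ^+ 2)
  (fun x => c ^+ 2 + - (2 * c) * f x)
  (B ^+ 2) (`|c ^+ 2| + `|2 * c| * B))//; last 2 first.
- exact: measurable_funD.
- by move=> x; rewrite (le_trans (ler_normD _ _))// lerD2l.
rewrite (@bounded_RintegralD (cst (c ^+ 2)) (fun x => - (2 * c) * f x)
  `|c ^+ 2| (`|2 * c| * B))//.
rewrite (@bounded_RintegralZl f B)// Rintegral_cst_probability -/c; ring.
Qed.

Lemma variance_ae_eq f g :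
  measurable_fun [set: T] f -> measurable_fun [set: T] g ->
  {ae m, forall x, f x = g x} -> 'V_m[f] = 'V_m[g].
Proof.
move=> mf mg fg; rewrite /variance !covariance.unlock !expectation.unlock.
have -> : (\int[m]_w (f w)%:E = \int[m]_w (g w)%:E)%E.
  apply: ae_eq_integral => //; [exact/measurable_EFinP|exact/measurable_EFinP|].
  by apply: filterS fg => x fgx _; congr EFin.
apply: ae_eq_integral => //.
- by apply/measurable_EFinP/measurable_funM; exact: measurable_funB.
- by apply/measurable_EFinP/measurable_funM; exact: measurable_funB.
by apply: filterS fg => x fgx _; congr (((_ - _) * (_ - _))%:E).
Qed.

End bounded_Rintegral.

Lemma normr_Rintegral_le d (T : measurableType d) (R : realType)
    (m : probability T R) (f : T -> R) (B : R) :
  measurable_fun [set: T] f -> (forall x, `|f x| <= B) ->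
  `|\int[m]_x f x| <= B.
Proof.
move=> mf fB; have intf := bounded_integrable m mf fB.
apply: le_trans (le_normr_Rintegral _ intf) _ => //.
apply: (@le_trans _ _ (\int[m]_x cst B x)).
  apply: le_Rintegral => //; last exact: finite_measure_integrable_cst.
  by apply: (@bounded_integrable _ _ _ _ _ B) => [|x];
    [exact: measurableT_comp|rewrite normr_id].
by rewrite Rintegral_cst_probability.
Qed.

Section conditional_expectation_theory.
Context (d : nat) (disp : 'I_d -> measure_display).
Variable T : forall i : 'I_d, measurableType (disp i).
Context (R : realType) (mu : probability (prod_space T) R).
Implicit Types (S : {set 'I_d}) (f g : prod_space T -> R).

Lemma is_cond_exp_measurable S f g :
  is_cond_exp mu (coord_sigma T S) f g -> measurable_fun [set: prod_space T] g.
Proof.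
by case=> Sg _ _ _ B mB; rewrite setTI; exact: coord_sigma_measurable (Sg _ mB).
Qed.

(** The set [D] where [g1 < g2] lies in [sigma(X_S)], so both versions have there the integral of
    [f]. The positive function [g2 - g1] thus has integral zero on [D], which makes [D] null. *)
Let is_cond_exp_le S f g1 g2 : is_cond_exp mu (coord_sigma T S) f g1 ->
  is_cond_exp mu (coord_sigma T S) f g2 -> {ae mu, forall x, g2 x <= g1 x}.
Proof.
move=> h1 h2; have [Sg1 int1 E1] := h1; have [Sg2 int2 E2] := h2.
pose D := [set x | g1 x < g2 x].
have SD : coord_sigma T S D.
  have mS (g : prod_space T -> R) :
      (forall B : set R, measurable B -> coord_sigma T S (g @^-1` B)) ->
      measurable_fun [set: g_sigma_algebraType (coord_sets T S)] g.
    by move=> Sg _ B mB; rewrite setTI; exact: Sg.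
  rewrite -[D]setTI.
  exact: (measurable_fun_ltr (mS _ Sg1) (mS _ Sg2) measurableT
    (Y := [set true])).
have mD := coord_sigma_measurable SD.
have mg1 := is_cond_exp_measurable h1.
have mg2 := is_cond_exp_measurable h2.
have mg21 : measurable_fun D (fun x => (g2 x - g1 x)%:E).
  by apply/measurable_EFinP/measurable_funTS/measurable_funB.
have /(ae_eq_integral_abs _ mD mg21) :
    (\int[mu]_(x in D) `|(g2 x - g1 x)%:E| = 0)%E.
  transitivity (\int[mu]_(x in D) ((g2 x)%:E - (g1 x)%:E))%E.
    apply: eq_integral => x /[!inE] Dx.
    by rewrite gee0_abs// lee_fin subr_ge0 ltW.
  rewrite integralB//; [|exact: integrableS int2|exact: integrableS int1].
  rewrite E2// -E1// subee//; apply: integrable_fin_num => //.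
  exact: integrableS int1.
apply: filterS => x gx; rewrite leNgt; apply/negP => Dx.
by have [] := gx Dx; move/eqP; rewrite subr_eq0 gt_eqF.
Qed.

Lemma is_cond_exp_unique S f g1 g2 : is_cond_exp mu (coord_sigma T S) f g1 ->
  is_cond_exp mu (coord_sigma T S) f g2 -> {ae mu, forall x, g1 x = g2 x}.
Proof.
move=> h1 h2; apply: filterS2 (is_cond_exp_le h1 h2) (is_cond_exp_le h2 h1).
by move=> x le21 le12; apply/eqP; rewrite eq_le le12.
Qed.

End conditional_expectation_theory.

Section sobol_numerator.
Context (d : nat) (disp : 'I_d -> measure_display).
Variable T : forall i : 'I_d, measurableType (disp i).
Context (R : realType) (mui : forall i, probability (T i) R).
Variable mu : probability (prod_space T) R.
Hypothesis mu_prod : is_product_measure mui mu.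
Variables (q : prod_space T -> R) (G : R).
Hypotheses (mq : measurable_fun [set: prod_space T] q)
  (qG : forall x, `|q x| <= G).
Implicit Types S : {set 'I_d}.

Local Notation Q := (mu \x mu)%E.

Definition freeze_mean S (x : prod_space T) : R :=
  \int[mu]_x' q (hybrid S x x').

Lemma hybrid_hybrid S (x x' y : prod_space T) :
  hybrid S (hybrid S x x') y = hybrid S x y.
Proof.
apply: functional_extensionality_dep => i; rewrite /hybrid.
by case: (i \in S).
Qed.

Let freeze_mean_hybrid S x x' : freeze_mean S (hybrid S x x') = freeze_mean S x.
Proof. by apply: eq_Rintegral => y _; rewrite hybrid_hybrid. Qed.

Let mqh S : measurable_fun [set: prod_space T * prod_space T]
  (fun z => q (hybrid S z.1 z.2)).
Proof. exact: measurableT_comp mq (@measurable_hybrid _ _ T S). Qed.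

Lemma measurable_freeze_mean S :
  measurable_fun [set: prod_space T] (freeze_mean S).
Proof.
exact: (@measurable_Rintegral_section _ _ _ _ _ mu mu
  (fun z => q (hybrid S z.1 z.2)) G (mqh S) (fun z => qG _)).
Qed.

Lemma freeze_mean_bounded S x : `|freeze_mean S x| <= G.
Proof.
apply: (@normr_Rintegral_le _ _ _ mu) => // .
exact: (measurable_section (mqh S)).
Qed.

Let normM (a b A B : R) : `|a| <= A -> `|b| <= B -> `|a * b| <= A * B.
Proof. by move=> aA bB; rewrite normrM ler_pM. Qed.

Lemma Rintegral_hybrid_prod S (h : prod_space T -> R) (H : R) :
  measurable_fun [set: prod_space T] h -> (forall x, `|h x| <= H) ->
  \int[Q]_z (h z.1 * q (hybrid S z.1 z.2)) =
  \int[mu]_x (h x * freeze_mean S x).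
Proof.
move=> mh hH.
rewrite (@Rintegral_prod _ _ _ _ _ _ _
  (fun z => h z.1 * q (hybrid S z.1 z.2)) (H * G)).
- apply: eq_Rintegral => x _.
  exact: (@bounded_RintegralZl _ _ _ mu (fun y => q (hybrid S x y)) G (h x)
    (measurable_section (mqh S) x) (fun=> qG _)).
- by apply: measurable_funM => //; exact: measurableT_comp.
- by move=> z; exact: normM.
Qed.

(** The hybrid point has law [mu] and [h] does not see the coordinates replaced in it; integrating
    those out turns [q] into [freeze_mean S]. With [h] an indicator this is the defining property of
    a conditional expectation; with [h] equal to [freeze_mean S] it computes a second moment. *)
Lemma Rintegral_mul_freeze S (h : prod_space T -> R) (H : R) :
  measurable_fun [set: prod_space T] h -> (forall x, `|h x| <= H) ->
  (forall x x', h (hybrid S x x') = h x) ->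
  \int[mu]_x (h x * q x) = \int[mu]_x (h x * freeze_mean S x).
Proof.
move=> mh hH hS; rewrite -(Rintegral_hybrid_prod S mh hH).
rewrite -(@Rintegral_hybrid _ _ _ _ _ _ mu_prod S (fun x => h x * q x) (H * G)).
- by apply: eq_Rintegral => z _; rewrite hS.
- exact: measurable_funM.
- by move=> z; exact: normM.
Qed.

Lemma is_cond_exp_freeze_mean S :
  is_cond_exp mu (coord_sigma T S) q (freeze_mean S).
Proof.
split.
(* Any base point serves: [freeze_mean S] is unchanged when the coordinates outside [S] are set to
   those of [x0]. *)
- move=> B mB; pose x0 : prod_space T := fun i => point.
  have : measurable (freeze_mean S @^-1` B).
    rewrite -[X in measurable X]setTI; exact: measurable_freeze_mean.
  move=> /(@measurable_hybrid_fixed _ _ T S x0 measurableT).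
  rewrite setTI => SB; rewrite (_ : _ @^-1` B =
    (fun x => hybrid S x x0) @^-1` (freeze_mean S @^-1` B)) //.
  by apply/funext => x; rewrite /preimage /mkset freeze_mean_hybrid.
- exact: (bounded_integrable _ (measurable_freeze_mean S)
    (freeze_mean_bounded S)).
- move=> A SA; have mA := coord_sigma_measurable SA.
  rewrite (@integral_indicM _ _ _ _ _ G)//;
    [|exact: measurable_freeze_mean|exact: freeze_mean_bounded].
  rewrite (@integral_indicM _ _ _ _ _ G)//; congr EFin.
  under eq_Rintegral do rewrite mulrC.
  under [RHS]eq_Rintegral do rewrite mulrC.
  apply/esym/(@Rintegral_mul_freeze S _ 1).
  + exact: measurable_indic.
  + by move=> x; rewrite indicE; case: (_ \in _); rewrite ?normr1 ?normr0.
  + move=> x x'; rewrite !indicE /in_mem /= /in_set /=.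
    by rewrite (coord_sigma_hybrid _ _ SA).
Qed.

(** Since a version exists, the one chosen by [xget] is genuine, and uniqueness up to null sets lets
    [freeze_mean S], say [g], replace it. Then [E[g^2] = E[g q] = E[q(X) q(X^S)]] and [E[g] =
    E[q]]. *)
Lemma variance_cond_exp S :
  fine 'V_mu[cond_exp mu (coord_sigma T S) q] =
  \int[Q]_z (q z.1 * q (hybrid S z.1 z.2)) - (\int[mu]_x q x) ^+ 2.
Proof.
have ex : is_cond_exp mu (coord_sigma T S) q (cond_exp mu (coord_sigma T S) q).
  exact: (xgetPex (cst 0) (ex_intro _ _ (is_cond_exp_freeze_mean S))).
have mg := measurable_freeze_mean S.
have gG := freeze_mean_bounded S.
rewrite (@variance_ae_eq _ _ _ mu _ (freeze_mean S)) => [|||]; last 3 first.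
- exact: is_cond_exp_measurable ex.
- by [].
- exact: is_cond_exp_unique ex (is_cond_exp_freeze_mean S).
have [_ ->] := varianceE_bounded mu mg gG; congr (_ - _ ^+ 2).
  rewrite (Rintegral_hybrid_prod S mq qG).
  under [RHS]eq_Rintegral do rewrite mulrC.
  exact/esym/(Rintegral_mul_freeze mg gG).
rewrite -(Rintegral_hybrid mu_prod S mq qG).
by rewrite (@Rintegral_prod _ _ _ _ _ _ _ (fun z => q (hybrid S z.1 z.2)) G).
Qed.

End sobol_numerator.

(** * The Saltelli estimator *)

Section ratio_estimate.
Context (R : realType).

(** With [a] the true mean, this expresses the empirical variance, whose terms are dependent through
    the empirical mean, by two averages of independent terms. *)
Lemma empirical_var_shift (E : Type) (q : E -> R) (M : nat) (x : 'I_M -> E)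
    (a : R) :
  (0 < M)%N ->
  M%:R^-1 * (\sum_(i < M) (q (x i) - M%:R^-1 * (\sum_(i < M) q (x i))) ^+ 2) =
  M%:R^-1 * (\sum_(i < M) (q (x i) - a) ^+ 2) -
  (M%:R^-1 * (\sum_(i < M) (q (x i) - a))) ^+ 2.
Proof.
move=> M0; have MN0 : M%:R != 0 :> R by rewrite pnatr_eq0 -lt0n.
have sumE c : \sum_(i < M) (q (x i) - c) = \sum_(i < M) q (x i) - M%:R * c.
  by rewrite sumrB sumr_const card_ord mulr_natl.
have sqE c : \sum_(i < M) (q (x i) - c) ^+ 2 =
    \sum_(i < M) q (x i) ^+ 2 - 2 * c * \sum_(i < M) q (x i) + M%:R * c ^+ 2.
  have -> : M%:R * c ^+ 2 = \sum_(i < M) c ^+ 2.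
    by rewrite sumr_const card_ord mulr_natl.
  by rewrite mulr_sumr -sumrB -big_split; apply: eq_bigr => i _ /=; ring.
by rewrite !sqE sumE; field.
Qed.

(** The error is [(N - Th * V - Th * (V' - V)) / V']. Its numerator is at most [3 * t], and
    [V' >= V / 2] because [2 * t <= V / 6]; in particular the default value [0] is never taken. *)
Lemma ratio_deviation (N V' V Th t : R) :
  0 < V -> `|Th| <= 1 -> t <= V / 12 ->
  `|N - Th * V| <= t -> `|V' - V| <= 2 * t ->
  `|(if V' == 0 then 0 else N / V') - Th| <= 6 * t / V.
Proof.
move=> V0 Th1 tV NV /ler_normlP[V'V1 V'V2].
have V'0 : V / 2 <= V' by lra.
have V'gt0 : 0 < V' by lra.
rewrite gt_eqF//.
have -> : N / V' - Th = (N - Th * V - Th * (V' - V)) / V'.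
  by field; rewrite gt_eqF.
rewrite normrM normfV (gtr0_norm V'gt0) ler_pdivrMr//.
have : `|N - Th * V - Th * (V' - V)| <= 3 * t.
  apply: le_trans (ler_normB _ _) _; rewrite normrM.
  have : `|Th| * `|V' - V| <= 1 * (2 * t).
    by rewrite ler_pM// ler_norml; apply/andP; split; lra.
  lra.
move=> /le_trans; apply.
have t0 : 0 <= t by rewrite (le_trans _ NV).
have -> : 3 * t = 6 * t / V * (V / 2) by field; rewrite gt_eqF.
by rewrite ler_wpM2l// divr_ge0 ?(ltW V0)// mulr_ge0.
Qed.

End ratio_estimate.

Section pick_freeze_independence.
Context (d : nat) (disp : 'I_d -> measure_display).
Variable T : forall i : 'I_d, measurableType (disp i).
Context (R : realType) dW (W : measurableType dW) (P : probability W R).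
Variables (mu : probability (prod_space T) R) (M : nat).
Variables X X' : 'I_M -> {mfun W >-> prod_space T}.
Hypothesis rows : pick_freeze_rows P mu X X'.

Local Notation Q := (mu \x mu)%E.
Local Notation Z := (fun i w => (X i w, X' i w)).

Lemma measurable_row i : measurable_fun [set: W] (Z i).
Proof. by apply/measurable_fun_pairP; split; exact: measurable_funP. Qed.

(** The independence of all [2M] points is applied to the full index set, and its factors are
    regrouped into pairs. *)
Lemma rows_independent (A B : 'I_M -> set (prod_space T)) :
  (forall i, measurable (A i)) -> (forall i, measurable (B i)) ->
  P [set w | forall i, (A i `*` B i) (Z i w)] = (\prod_i Q (A i `*` B i))%E.
Proof.
move=> mA mB; have [XE X'E indep] := rows.
pose D (s : 'I_M + 'I_M) := match s with inl i => A i | inr i => B i end.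
have mD s : measurable (D s) by case: s.
have := indep [set: 'I_M + 'I_M]%SET D mD.
rewrite (_ : \bigcap_(s in _) _ = [set w | forall i, (A i `*` B i) (Z i w)]).
  move=> ->; rewrite (eq_bigl xpredT); last by move=> s; rewrite finset.in_setT.
  have QE i : Q (A i `*` B i) = (mu (A i) * mu (B i))%E.
    exact: (product_measure1E mu mu (mA i) (mB i)).
  under [RHS]eq_bigr do rewrite QE.
  rewrite [RHS]big_split big_sumType/=; congr (_ * _)%E; apply: eq_bigr => i _.
    exact: XE.
  exact: X'E.
apply/seteqP; split => w /= h.
  by move=> i; split; [apply: (h (inl i))|apply: (h (inr i))];
    rewrite /= finset.in_setT.
by move=> [i|i] _; have [] := h i.
Qed.

(** The law of a single row follows from the product formula with every other factor equal to
    [1]. *)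
Lemma integral_row i (f : prod_space T * prod_space T -> R) (b : R) :
  measurable_fun [set: prod_space T * prod_space T] f ->
  (forall z, 0 <= f z <= b) ->
  (\int[P]_w (f (Z i w))%:E = \int[Q]_z (f z)%:E)%E.
Proof.
move=> mf fb; pose g (j : 'I_M) := if j == i then f else cst 1.
have := @expectation_prod_independent _ _ _ _ _ _ _ _ P Q _
  measurable_row rows_independent g (Num.max b 1).
have gNi j : j != i -> g j = cst 1 by rewrite /g => /negbTE ->.
have gi : g i = f by rewrite /g eqxx.
rewrite (bigD1 i)//= big1 ?mule1; last first.
  move=> j ji; rewrite gNi//; transitivity (\int[Q]_z cst 1%E z)%E => //.
  by rewrite integral_cst// mul1e; exact: (probability_setT Q).
rewrite gi => <-; last 2 first.
- by move=> j; rewrite /g; case: ifP.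
- move=> j z; rewrite /g; case: ifP => _.
    by have /andP[-> fzb] := fb z; rewrite le_max fzb.
  by rewrite /= ler01 le_max lexx orbT.
apply: eq_integral => w _; congr EFin; rewrite (bigD1 i)//= big1 ?mulr1.
  by rewrite gi.
by move=> j ji; rewrite gNi.
Qed.

End pick_freeze_independence.

Section bounded_model.
Context (d : nat) (disp : 'I_d -> measure_display).
Variable T : forall i : 'I_d, measurableType (disp i).
Context (R : realType) (mui : forall i, probability (T i) R).
Variable mu : probability (prod_space T) R.
Hypothesis mu_prod : is_product_measure mui mu.
Variables (q : prod_space T -> R) (G : R).
Hypotheses (mq : measurable_fun [set: prod_space T] q)
  (qG : forall x, `|q x| <= G).
Implicit Types S : {set 'I_d}.

Local Notation Q := (mu \x mu)%E.
Let m0 := \int[mu]_x q x.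
Let V := fine 'V_mu[q].
Let tau S := fine 'V_mu[cond_exp mu (coord_sigma T S) q].

Let G0 : 0 <= G.
Proof. by apply: le_trans (qG (fun=> point)). Qed.

Let sqr_le (a B : R) : `|a| <= B -> `|a ^+ 2| <= B ^+ 2.
Proof. by move=> aB; rewrite normrX lerXn2r// nnegrE// (le_trans _ aB). Qed.

Let mq2 : measurable_fun [set: prod_space T] (fun x => q x ^+ 2).
Proof. exact: measurable_funX. Qed.

Let m0G : `|m0| <= G.
Proof. exact: normr_Rintegral_le. Qed.

Let VE : V = \int[mu]_x (q x - m0) ^+ 2.
Proof. by have [] := varianceE_bounded mu mq qG. Qed.

Let VE2 : V = \int[mu]_x (q x ^+ 2) - m0 ^+ 2.
Proof. by have [] := varianceE_bounded mu mq qG. Qed.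

Lemma variance_bounded : 0 <= V <= G ^+ 2.
Proof.
apply/andP; split.
  by rewrite VE; apply: Rintegral_ge0 => x _; exact: sqr_ge0.
have := normr_Rintegral_le mu mq2 (fun x => sqr_le (qG x)).
by move=> /ler_normlP[_]; rewrite VE2; have := sqr_ge0 m0; lra.
Qed.

Lemma Rintegral_fst (f : prod_space T -> R) (B : R) :
  measurable_fun [set: prod_space T] f -> (forall x, `|f x| <= B) ->
  \int[Q]_z f z.1 = \int[mu]_x f x.
Proof.
move=> mf fB; rewrite (@Rintegral_prod _ _ _ _ _ mu mu (fun z => f z.1) B)//.
  apply: eq_Rintegral => x _.
  exact: (@Rintegral_cst_probability _ _ _ mu (f x)).
exact: measurableT_comp.
Qed.

Let mq1 : measurable_fun [set: prod_space T * prod_space T] (fun z => q z.1).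
Proof. exact: measurableT_comp. Qed.

Let mqs : measurable_fun [set: prod_space T * prod_space T] (fun z => q z.2).
Proof. exact: measurableT_comp. Qed.

Let mqh S : measurable_fun [set: prod_space T * prod_space T]
  (fun z => q (hybrid S z.1 z.2)).
Proof. exact: measurableT_comp mq (@measurable_hybrid _ _ T S). Qed.

Let tauE S : tau S = \int[Q]_z (q z.1 * q (hybrid S z.1 z.2)) - m0 ^+ 2.
Proof. by rewrite /tau (variance_cond_exp mu_prod mq qG S). Qed.

(** The upper bound is [a * b <= (a ^+ 2 + b ^+ 2) / 2] under the integral, both squares having the
    same expectation because the hybrid point has law [mu]. *)
Lemma variance_cond_exp_le S : 0 <= tau S <= V.
Proof.
apply/andP; split; first by apply: fine_ge0; exact: variance_ge0.
rewrite tauE VE2 lerD2r.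
have q2B x := sqr_le (qG x).
have mh : measurable_fun [set: prod_space T * prod_space T]
    (fun z => q (hybrid S z.1 z.2) ^+ 2) by exact: measurable_funX.
have mf : measurable_fun [set: prod_space T * prod_space T]
    (fun z => q z.1 ^+ 2).
  exact: measurable_funX.
have E : \int[Q]_z (2^-1 * (q z.1 ^+ 2 + q (hybrid S z.1 z.2) ^+ 2)) =
    \int[mu]_x (q x ^+ 2).
  rewrite (@bounded_RintegralZl _ _ _ Q
    (fun z => q z.1 ^+ 2 + q (hybrid S z.1 z.2) ^+ 2) (G ^+ 2 + G ^+ 2)).
  - rewrite (@bounded_RintegralD _ _ _ Q (fun z => q z.1 ^+ 2)
      (fun z => q (hybrid S z.1 z.2) ^+ 2) (G ^+ 2) (G ^+ 2))//.
    rewrite (Rintegral_fst mq2 q2B) (Rintegral_hybrid mu_prod S mq2 q2B); lra.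
  - exact: measurable_funD.
  - by move=> z; rewrite (le_trans (ler_normD _ _))// lerD.
rewrite -E; apply: le_Rintegral => //.
- apply: (@bounded_integrable _ _ _ _ _ (G * G)); first exact: measurable_funM.
  by move=> z; rewrite normrM ler_pM.
- apply: (@bounded_integrable _ _ _ _ _ (2^-1 * (G ^+ 2 + G ^+ 2))).
    by apply: measurable_funM => //; exact: measurable_funD.
  move=> z; rewrite normrM ger0_norm ?invr_ge0// ler_wpM2l ?invr_ge0//.
  by rewrite (le_trans (ler_normD _ _))// lerD.
- by move=> z _; have := sqr_ge0 (q z.1 - q (hybrid S z.1 z.2)); lra.
Qed.

Definition pick_freeze_test (j : option (option {set 'I_d}))
    (z : prod_space T * prod_space T) : R :=
  match j with
  | None => 2 * G * (q z.1 - m0)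
  | Some None => (q z.1 - m0) ^+ 2 - V
  | Some (Some U) => q z.1 * (q (hybrid U z.1 z.2) - q z.2) - tau U
  end.

Lemma measurable_pick_freeze_test j :
  measurable_fun [set: prod_space T * prod_space T] (pick_freeze_test j).
Proof.
case: j => [[S|]|]; rewrite /pick_freeze_test.
- apply: measurable_funB => //; apply: measurable_funM => //.
  exact: measurable_funB.
- apply: measurable_funB => //; apply: measurable_funX.
  exact: measurable_funB.
- by apply: measurable_funM => //; exact: measurable_funB.
Qed.

Let qm0 x : `|q x - m0| <= 2 * G.
Proof.
by apply: le_trans (ler_normB _ _) _; rewrite mulr_natl mulr2n lerD.
Qed.

(** The three kinds of test are bounded by [3], [5] and [4] times [G ^+ 2]; [8] is a common round
    value. *)
Lemma pick_freeze_test_bounded j z : `|pick_freeze_test j z| <= 8 * G ^+ 2.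
Proof.
have /andP[V0 VG] := variance_bounded; have G2 := sqr_ge0 G.
case: j => [[S|]|]; rewrite /pick_freeze_test.
- apply: le_trans (ler_normB _ _) _.
  have /andP[t0 tV] := variance_cond_exp_le S; rewrite (ger0_norm t0) normrM.
  have : `|q z.1| * `|q (hybrid S z.1 z.2) - q z.2| <= G * (2 * G).
    apply: ler_pM => //; apply: le_trans (ler_normB _ _) _.
    by rewrite mulr_natl mulr2n lerD.
  lra.
- apply: le_trans (ler_normB _ _) _; rewrite (ger0_norm V0).
  by have := sqr_le (qm0 z.1); lra.
- rewrite !normrM (ger0_norm G0) ger0_norm//.
  have : 2 * G * `|q z.1 - m0| <= 2 * G * (2 * G).
    by rewrite ler_wpM2l// mulr_ge0.
  lra.
Qed.

(** For the numerators, Fubini gives [E[q(X) q(X')] = m0 ^+ 2], the same square that is subtracted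
    in [tauE]. *)
Lemma pick_freeze_test_centered j : \int[Q]_z pick_freeze_test j z = 0.
Proof.
case: j => [[S|]|]; rewrite /pick_freeze_test.
- have -> : \int[Q]_z (q z.1 * (q (hybrid S z.1 z.2) - q z.2) - tau S) =
    \int[Q]_z (q z.1 * q (hybrid S z.1 z.2) + (-1 * (q z.1 * q z.2) + - tau S)).
    by apply: eq_Rintegral => z _; ring.
  have m12 : measurable_fun [set: prod_space T * prod_space T]
      (fun z => q z.1 * q z.2).
    exact: measurable_funM.
  have b12 z : `|q z.1 * q z.2| <= G * G by rewrite normrM ler_pM.
  have b12' (z : prod_space T * prod_space T) :
      `|-1 * (q z.1 * q z.2)| <= G * G.
    by rewrite mulN1r normrN.
  have mN12 : measurable_fun [set: prod_space T * prod_space T]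
      (fun z => -1 * (q z.1 * q z.2)).
    exact: measurable_funM.
  rewrite (@bounded_RintegralD _ _ _ Q (fun z => q z.1 * q (hybrid S z.1 z.2))
    (fun z => -1 * (q z.1 * q z.2) + - tau S) (G * G)
    (G * G + `|tau S|)); first last.
  + by move=> z; apply: le_trans (ler_normD _ _) _; rewrite normrN lerD2r.
  + by move=> z; rewrite normrM ler_pM.
  + exact: measurable_funD.
  + exact: measurable_funM.
  rewrite (@bounded_RintegralD _ _ _ Q (fun z => -1 * (q z.1 * q z.2))
    (fun=> - tau S) (G * G) `|tau S|)//; last by move=> z; rewrite normrN.
  rewrite (@bounded_RintegralZl _ _ _ Q (fun z => q z.1 * q z.2) (G * G))//.
  rewrite (Rintegral_cst_probability Q).
  rewrite (@Rintegral_prod _ _ _ _ _ mu mu (fun z => q z.1 * q z.2) (G * G))//.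
  have -> : \int[mu]_x \int[mu]_y (q (x, y).1 * q (x, y).2) =
      \int[mu]_x (m0 * q x).
    apply: eq_Rintegral => x _; rewrite [RHS]mulrC.
    exact: (@bounded_RintegralZl _ _ _ mu q G (q x)).
  rewrite (@bounded_RintegralZl _ _ _ mu q G)// tauE -/m0; ring.
- have mc : measurable_fun [set: prod_space T] (fun x => (q x - m0) ^+ 2).
    by apply: measurable_funX; exact: measurable_funB.
  rewrite (@Rintegral_fst (fun x => (q x - m0) ^+ 2 - V) ((2 * G) ^+ 2 + `|V|)).
  + rewrite (@bounded_RintegralD _ _ _ mu (fun x => (q x - m0) ^+ 2) (fun=> - V)
      ((2 * G) ^+ 2) `|V|)//.
    * by rewrite Rintegral_cst_probability -VE subrr.
    * by move=> x; exact: sqr_le.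
    * by move=> x; rewrite normrN.
  + exact: measurable_funB.
  + move=> x; apply: le_trans (ler_normB _ _) _; rewrite lerD2r; exact: sqr_le.
- rewrite (@Rintegral_fst (fun x => 2 * G * (q x - m0)) (`|2 * G| * (2 * G))).
  + rewrite (@bounded_RintegralZl _ _ _ mu (fun x => q x - m0) (2 * G))//.
      rewrite (@bounded_RintegralD _ _ _ mu q (fun=> - m0) G `|m0|)//.
        by rewrite Rintegral_cst_probability subrr mulr0.
      by move=> x; rewrite normrN.
    exact: measurable_funB.
  + by apply: measurable_funM => //; exact: measurable_funB.
  + by move=> x; rewrite normrM ler_wpM2l.
Qed.

Lemma closed_sobol_le1 S : 0 < V -> 0 <= closed_sobol mu q S <= 1.
Proof.
move=> V0; have /andP[t0 tV] := variance_cond_exp_le S.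
by rewrite /closed_sobol ler_pdivrMr// mul1r divr_ge0 ?(ltW V0).
Qed.

Context dW (W : measurableType dW) (P : probability W R) (M : nat).
Variables X X' : 'I_M -> {mfun W >-> prod_space T}.
Hypotheses (rows : pick_freeze_rows P mu X X') (M0 : (0 < M)%N).

Lemma saltelli_concentration (C : {set {set 'I_d}}) (t : R) :
  0 < V -> 0 < t <= V / 12 ->
  exists bad : set W, [/\ measurable bad,
    (P bad <= (2 * (#|C| + 2)%:R *
       expR (- (M%:R * t ^+ 2 / (512 * G ^+ 4))))%:E)%E &
    forall w, ~ bad w -> forall S, S \in C ->
      `|saltelli q (X ^~ w) (X' ^~ w) S - closed_sobol mu q S| <= 6 * t / V].
Proof.
move=> V0 /andP[t0 tV]; have /andP[_ VG] := variance_bounded.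
have Ggt0 : 0 < G.
  rewrite lt_neqAle G0 andbT; apply/eqP => GE.
  by move: VG; rewrite -GE expr0n/=; lra.
pose s : seq (option (option {set 'I_d})) :=
  None :: Some None :: [seq Some (Some U) | U <- enum C].
have sizes : size s = (#|C| + 2)%N by rewrite /= size_map -cardE addn2.
(* The range condition of the tail bound holds because [t <= V / 12] and [V <= G ^+ 2]. *)
have tB : 0 < t <= 2 * (8 * G ^+ 2) by rewrite t0/=; lra.
have [mbad Pbad] := sums_concentration (measurable_row X X')
  (rows_independent rows) s measurable_pick_freeze_test
  pick_freeze_test_bounded pick_freeze_test_centered tB.
eexists; split; [exact: mbad| |].
  apply: le_trans Pbad _; rewrite sizes lee_fin.
  by rewrite (_ : 8 * (8 * G ^+ 2) ^+ 2 = 512 * G ^+ 4)//; ring.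
move=> w /negP/seq.hasPn nbad S SC.
have Mn0 : M%:R != 0 :> R by rewrite pnatr_eq0 -lt0n.
have avgB (u : 'I_M -> R) (c : R) :
    M%:R^-1 * \sum_i (u i - c) = M%:R^-1 * \sum_i u i - c.
  rewrite sumrB sumr_const card_ord mulrBr; congr (_ - _).
  by rewrite -[c *+ M]mulr_natl mulKf.
have small j : j \in s ->
    `|M%:R^-1 * \sum_i pick_freeze_test j (X i w, X' i w)| <= t.
  move=> /nbad; rewrite -ltNge => /ltW h.
  by rewrite normrM normfV (ger0_norm (ler0n R M)) ler_pdivrMl ?ltr0n.
pose a := M%:R^-1 * \sum_i (q (X i w) - m0) ^+ 2.
pose b := M%:R^-1 * \sum_i (q (X i w) - m0).
have aV : `|a - V| <= t.
  have := small (Some None); rewrite /pick_freeze_test avgB; apply.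
  by rewrite !inE eqxx orbT.
have bt : b ^+ 2 <= t.
  have : `|2 * G * b| <= t.
    have := small None; rewrite /pick_freeze_test -mulr_sumr mulrCA; apply.
    by rewrite inE eqxx.
  rewrite normrM ger0_norm ?mulr_ge0//; apply: le_trans.
  rewrite -real_normK ?num_real// expr2 ler_wpM2r//.
  rewrite /b normrM normfV (ger0_norm (ler0n R M)) ler_pdivrMl ?ltr0n//.
  apply: le_trans (ler_norm_sum _ _ _) _.
  apply: le_trans (ler_sum _ (fun i _ => qm0 (X i w))) _.
  by rewrite sumr_const card_ord -[leLHS]mulr_natl.
apply: ratio_deviation => //.
- have /andP[T0 T1] := closed_sobol_le1 S V0; by rewrite ger0_norm.
- rewrite /closed_sobol -/V divfK ?gt_eqF//.
  have := small (Some (Some S)); rewrite /pick_freeze_test avgB; apply.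
  rewrite !inE/=; apply/mapP; exists S => //; by rewrite mem_enum.
(* The errors of [a] and of [b ^+ 2] are at most [t] each, whence the [2 * t]. *)
- have -> : empirical_var q (X ^~ w) = a - b ^+ 2 by exact: empirical_var_shift.
  have := sqr_ge0 b; move: aV; rewrite !ler_norml; lra.
Qed.

End bounded_model.

(** * Replacing the model by an almost everywhere equal one *)

Lemma ae_preimage d1 d2 (W : measurableType d1) (E : measurableType d2)
    (R : realType) (P : {measure set W -> \bar R})
    (mu : {measure set E -> \bar R})
    (Y : W -> E) (p : E -> Prop) :
  measurable_fun [set: W] Y ->
  (forall A, measurable A -> P (Y @^-1` A) = mu A) ->
  {ae mu, forall x, p x} -> {ae P, forall w, p (Y w)}.
Proof.
move=> mY PY [N [mN N0 pN]]; exists (Y @^-1` N); split.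
- by rewrite -[X in measurable X]setTI; exact: mY.
- by rewrite PY.
- by move=> w /= npw; exact: pN.
Qed.

Section almost_everywhere_model.
Context (d : nat) (disp : 'I_d -> measure_display).
Variable T : forall i : 'I_d, measurableType (disp i).
Context (R : realType) (mui : forall i, probability (T i) R).
Variable mu : probability (prod_space T) R.
Hypothesis mu_prod : is_product_measure mui mu.
Variables q q' : prod_space T -> R.
Hypotheses (mq : measurable_fun [set: prod_space T] q)
  (mq' : measurable_fun [set: prod_space T] q')
  (qq' : {ae mu, forall x, q x = q' x}).
Implicit Types S : {set 'I_d}.

(** The equality is exact: both functions have the same set of versions, so [xget] makes the same
    choice. *)
Lemma cond_exp_ae_eq S :
  cond_exp mu (coord_sigma T S) q = cond_exp mu (coord_sigma T S) q'.
Proof.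
rewrite /cond_exp; congr xget; apply/funext => g; apply/propext.
have qqA A : coord_sigma T S A ->
    (\int[mu]_(x in A) (q x)%:E = \int[mu]_(x in A) (q' x)%:E)%E.
  move=> /coord_sigma_measurable mA; apply: ae_eq_integral => //.
  - exact/measurable_EFinP/measurable_funTS.
  - exact/measurable_EFinP/measurable_funTS.
  - by apply: filterS qq' => x qx _; congr EFin.
by split=> -[mg ig Eg]; split => // A SA; rewrite Eg// qqA.
Qed.

Lemma closed_sobol_ae_eq S : closed_sobol mu q S = closed_sobol mu q' S.
Proof. by rewrite /closed_sobol cond_exp_ae_eq (variance_ae_eq mq mq' qq'). Qed.

Context dW (W : measurableType dW) (P : probability W R) (M : nat).
Variables X X' : 'I_M -> {mfun W >-> prod_space T}.
Hypothesis rows : pick_freeze_rows P mu X X'.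

Let measurable_hybrid_row S i :
  measurable_fun [set: W] (fun w => hybrid S (X i w) (X' i w) : prod_space T).
Proof.
exact: (measurableT_comp (@measurable_hybrid _ _ T S) (measurable_row X X' i)).
Qed.

Lemma hybrid_row_law S i (A : set (prod_space T)) : measurable A ->
  P ((fun w => hybrid S (X i w) (X' i w)) @^-1` A) = mu A.
Proof.
move=> mA.
pose h (z : prod_space T * prod_space T) : prod_space T := hybrid S z.1 z.2.
have mh := @measurable_hybrid _ _ T S.
have mhA : measurable (h @^-1` A).
  by rewrite -[X in measurable X]setTI; exact: mh.
have mA' : measurable ((fun w => hybrid S (X i w) (X' i w)) @^-1` A).
  by rewrite -[X in measurable X]setTI; exact: measurable_hybrid_row.
rewrite -(hybrid_law mu_prod S mA) /pushforward.
transitivity (\int[P]_w (\1_(h @^-1` A) (X i w, X' i w))%:E)%E.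
  transitivity (\int[P]_w
      (\1_((fun w => hybrid S (X i w) (X' i w)) @^-1` A) w)%:E)%E => //.
  by rewrite integral_indic// setIT.
rewrite (@integral_row _ _ _ _ _ _ P mu M X X' rows i (\1_(h @^-1` A)) 1).
- by rewrite integral_indic// setIT.
- exact: measurable_indic.
- by move=> z; rewrite indicE; case: (_ \in _); rewrite ?lexx ?ler01.
Qed.

(** The estimator evaluates the model at finitely many random points, over all [S] at once. Each has
    law [mu], the hybrid ones included, so almost surely none meets the null set. *)
Lemma saltelli_ae_eq :
  {ae P, forall w, forall S,
    saltelli q (X ^~ w) (X' ^~ w) S = saltelli q' (X ^~ w) (X' ^~ w) S}.
Proof.
have [XE X'E _] := rows.
have aeX i : {ae P, forall w, q (X i w) = q' (X i w)}.
  exact: (@ae_preimage _ _ _ _ _ P mu (X i) (fun x => q x = q' x)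
    (@measurable_funP _ _ _ _ setT (X i)) (XE i)).
have aeX' i : {ae P, forall w, q (X' i w) = q' (X' i w)}.
  exact: (@ae_preimage _ _ _ _ _ P mu (X' i) (fun x => q x = q' x)
    (@measurable_funP _ _ _ _ setT (X' i)) (X'E i)).
have aeh S i : {ae P, forall w,
    q (hybrid S (X i w) (X' i w)) = q' (hybrid S (X i w) (X' i w))}.
  exact: (@ae_preimage _ _ _ _ _ P mu _ (fun x => q x = q' x)
    (@measurable_hybrid_row S i) (@hybrid_row_law S i)).
have aeXT : {ae P, forall w, forall i, q (X i w) = q' (X i w)}.
  exact: filter_forall.
have aeX'T : {ae P, forall w, forall i, q (X' i w) = q' (X' i w)}.
  exact: filter_forall.
have aehT : {ae P, forall w, forall S, forall i,
    q (hybrid S (X i w) (X' i w)) = q' (hybrid S (X i w) (X' i w))}.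
  by apply: filter_forall => S; exact: filter_forall.
apply: filterS3 aeXT aeX'T aehT => w qX qX' qh S.
rewrite /saltelli /pick_freeze_num /empirical_var /empirical_mean.
have -> : \sum_(i < M) q (X i w) = \sum_(i < M) q' (X i w).
  exact: eq_bigr.
have -> : \sum_(i < M)
      q (X i w) * (q (hybrid S (X i w) (X' i w)) - q (X' i w)) =
    \sum_(i < M) q' (X i w) * (q' (hybrid S (X i w) (X' i w)) - q' (X' i w)).
  by apply: eq_bigr => i _; rewrite qX qX' qh.
by under eq_bigr do rewrite qX.
Qed.

End almost_everywhere_model.

(** * Measurability of the estimator, sample size and conclusion *)

Lemma measurable_saltelli (d : nat) (disp : 'I_d -> measure_display)
    (T : forall i : 'I_d, measurableType (disp i)) (R : realType)
    dW (W : measurableType dW) (M : nat)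
    (X X' : 'I_M -> {mfun W >-> prod_space T})
    (q : prod_space T -> R) (S : {set 'I_d}) :
  measurable_fun [set: prod_space T] q ->
  measurable_fun [set: W] (fun w => saltelli q (X ^~ w) (X' ^~ w) S).
Proof.
move=> mq.
have mX i : measurable_fun [set: W] (fun w => q (X i w)).
  exact: measurableT_comp.
have mX' i : measurable_fun [set: W] (fun w => q (X' i w)).
  exact: measurableT_comp.
have mh i : measurable_fun [set: W] (fun w => q (hybrid S (X i w) (X' i w))).
  exact: (measurableT_comp mq (measurableT_comp (@measurable_hybrid _ _ T S)
    (measurable_row X X' i))).
have mv : measurable_fun [set: W] (fun w => empirical_var q (X ^~ w)).
  apply: measurable_funM => //; apply: measurable_sum => i.
  apply: measurable_funX; apply: measurable_funB => //.
  by apply: measurable_funM => //; exact: measurable_sum.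
have mn : measurable_fun [set: W]
    (fun w => pick_freeze_num q (X ^~ w) (X' ^~ w) S).
  apply: measurable_funM => //; apply: measurable_sum => i.
  by apply: measurable_funM => //; exact: measurable_funB.
(* [x `^ (-1)] is [x^-1] for [0 <= x], and [0^-1 = 0]. *)
rewrite (_ : (fun w => _) = (fun w => pick_freeze_num q (X ^~ w) (X' ^~ w) S *
    empirical_var q (X ^~ w) `^ (-1))).
  apply: measurable_funM => //.
  exact: (measurableT_comp (measurable_powR _) mv).
apply/funext => w; rewrite /saltelli powR_inv1.
  by case: eqP => // ->; rewrite invr0 mulr0.
by rewrite mulr_ge0// sumr_ge0// => i _; exact: sqr_ge0.
Qed.

(** Put [u = eta / (2 * K)]. As [432 = 3 * 144], the exponent is at least [3 * ln u^-1], so the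
    exponential is at most [u ^+ 3]. One factor [u] pays for [K + 2], since [K * u = eta / 2] and
    [2 * u <= eta]; the other two, at most [1 / 2] each, bring the total down to [3 * eta / 4]. *)
Lemma pick_freeze_sample_size (R : realType) (K : nat)
    (c G v m theta eta M : R) :
  (0 < K)%N -> 0 < c -> 0 < G -> 0 < v -> 0 < m -> 0 < theta -> 0 < eta < 1 ->
  432 * c * (G ^+ 4 * (1 + theta) ^+ 2 / (v ^+ 2 * m ^+ 2)) *
    ln (2 * K%:R / eta) <= M ->
  0 < M /\
  2 * (K + 2)%:R *
    expR (- (M * (m * v / (12 * (1 + theta))) ^+ 2 / (c * G ^+ 4))) <= eta.
Proof.
move=> K0 c0 G0 v0 m0 theta0 /andP[eta0 eta1] hM.
have K1 : 1 <= K%:R :> R by rewrite ler1n.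
have th1 : 0 < 1 + theta by lra.
pose u := eta / (2 * K%:R).
have u0 : 0 < u by rewrite divr_gt0// mulr_gt0// ltr0n.
have uK : 2 * K%:R / eta = u^-1 by rewrite /u invf_div.
have uKe : K%:R * u = eta / 2 by rewrite /u; field; lra.
have u2 : u <= 1 / 2 by rewrite /u ler_pdivrMr; lra.
have L0 : 0 < ln u^-1.
  by apply: ln_gt0; rewrite invf_gt1//; lra.
set Y := G ^+ 4 * _ / _ in hM.
have Y0 : 0 < Y by rewrite divr_gt0 ?mulr_gt0 ?exprn_gt0.
rewrite uK in hM.
have c432 : 0 < 432 * c by rewrite (pmulr_lgt0 _ c0) ltr0n.
split; first exact: lt_le_trans (mulr_gt0 (mulr_gt0 c432 Y0) L0) hM.
have -> : M * (m * v / (12 * (1 + theta))) ^+ 2 / (c * G ^+ 4) =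
    M / (144 * c * Y).
  by rewrite /Y; field; rewrite !gt_eqF.
have ML : 3 * ln u^-1 <= M / (144 * c * Y).
  have cY0 : 0 < 144 * c * Y.
    by rewrite (pmulr_lgt0 _ Y0) (pmulr_lgt0 _ c0) ltr0n.
  rewrite (ler_pdivlMr _ _ cY0).
  apply: le_trans hM; rewrite le_eqVlt; apply/orP; left; apply/eqP; ring.
apply: (@le_trans _ _ (2 * (K + 2)%:R * u ^+ 3)).
  rewrite ler_wpM2l ?mulr_ge0//.
  have -> : u ^+ 3 = expR (- (3 * ln u^-1)).
    by rewrite lnV ?posrE// mulrN opprK expRM_natl lnK ?posrE.
  by rewrite ler_expR lerN2.
have -> : 2 * (K + 2)%:R * u ^+ 3 = 2 * (K%:R * u + 2 * u) * u ^+ 2.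
  by rewrite natrD; ring.
have uKe' : u <= eta / 2 by rewrite -uKe ler_peMl// ltW.
apply: (@le_trans _ _ (3 * eta * (1 / 2) ^+ 2)); last by lra.
clear hM ML L0 uK.
have uu : u ^+ 2 <= (1 / 2) ^+ 2 by rewrite lerXn2r// nnegrE; lra.
by apply: ler_pM uu; [lra|exact: sqr_ge0|lra].
Qed.

Theorem proposition4p7 (R : realType) :
  exists c : R, 0 < c /\
  forall (d : nat) (disp : 'I_d -> measure_display)
    (T : forall i : 'I_d, measurableType (disp i))
    (mui : forall i : 'I_d, probability (T i) R)
    (mu : probability (prod_space T) R)
    (k : nat) (q : prod_space T -> R) (theta m : R)
    (A : {set {set 'I_d}}),
  let C := subsets_of_card d k in
  let TS := closed_sobol mu q in
  let Tmax := max_over C TS in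
  is_product_measure mui mu ->
  q \in Lfun mu 2%:E ->
  (0 < 'V_mu[q])%E ->
  0 < theta < 1 ->
  0 < m ->
  A \subset C ->
  (forall S, S \in A -> m <= TS S - theta * Tmax) ->
  (forall S, S \in C :\: A -> TS S - theta * Tmax <= - m) ->
  (* (i) *)
  (forall (That : {set 'I_d} -> R) (e : R),
     max_over C (fun S => `|That S - TS S|) <= e ->
     e < m / (1 + theta) ->
     threshold_select C theta That = A)
  /\
  (* (ii) *)
  (forall (G vmin eta : R) (dW : measure_display) (W : measurableType dW)
     (P : probability W R) (M : nat)
     (X X' : 'I_M -> {mfun W >-> prod_space T}),
     ('N[mu]_+oo[EFin \o q] <= G%:E)%E ->
     0 < vmin ->
     (vmin%:E <= 'V_mu[q])%E ->
     0 < eta < 1 ->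
     pick_freeze_rows P mu X X' ->
     c * (G ^+ 4 * (1 + theta) ^+ 2 / (vmin ^+ 2 * m ^+ 2))
       * ln (2 * #|C|%:R / eta) <= M%:R ->
     exists e : R, e < m / (1 + theta) /\
       ((1 - eta)%:E <=
        P [set w | (max_over C (fun S =>
             `|saltelli q (X ^~ w) (X' ^~ w) S - TS S|) <= e)%R])%E).
Proof.
(* The factor [512] is the one in the tail exponent of [saltelli_concentration]; [432] comes from
   the sample size computation. *)
exists (432 * 512); split; first by apply: mulr_gt0; rewrite ltr0n.
move=> d disp T mui mu k q theta m A C TS Tmax mu_prod qL2 Vq theta01 m0 AC.
move=> sepA sepCA; have /andP[theta0 theta1] := theta01; split.
  move=> That e; exact: threshold_select_stable sepA sepCA.
move=> G vmin eta dW W P M X X' qG v0 vV eta01 rows hM.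
have /andP[eta0 eta1] := eta01.
have th1 : 0 < 1 + theta by lra.
have mq : measurable_fun [set: prod_space T] q.
  by have := sub_Lfun_mfun qL2; rewrite inE.
have aeG : {ae mu, forall x, `|q x| <= G}.
  move: qG; rewrite Lnorm.unlock.
  have -> : (0 < mu [set: prod_space T])%E by rewrite [mu _]probability_setT.
  by move=> /ess_supP; apply: filterS => x /=; rewrite lee_fin.
(* The almost everywhere bound holds at some point, because a null set is not the whole space. *)
have G0 : 0 <= G.
  have [N [mN N0 GN]] := aeG.
  have [x Nx] : exists x, ~ N x.
    apply/existsNP => NT; have : mu [set: prod_space T] = 0%E.
      by rewrite (_ : [set: _] = N)//; apply/seteqP; split.
    by rewrite probability_setT => /eqP; rewrite onee_eq0.
  apply: le_trans (normr_ge0 (q x)) _.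
  by apply: contrapT => nG; apply: Nx; exact: GN.
pose q' x : R := Num.max (- G) (Num.min G (q x)).
have mq' : measurable_fun [set: prod_space T] q'.
  by apply: measurable_maxr => //; exact: measurable_minr.
have q'G x : `|q' x| <= G.
  by rewrite /q' ler_norml le_max lexx/= ge_max ge_min lexx/= andbT; lra.
have qq' : {ae mu, forall x, q x = q' x}.
  apply: filterS aeG => x /=; rewrite ler_norml => /andP[Gq qG'].
  by rewrite /q' min_r// max_r.
have TSE S : TS S = closed_sobol mu q' S by exact: closed_sobol_ae_eq.
set V := fine 'V_mu[q'].
have vV' : vmin <= V.
  have VE : 'V_mu[q] = 'V_mu[q'] by exact: variance_ae_eq.
  rewrite -lee_fin /V -VE fineK//; exact: variance_fin_num.
have V0 : 0 < V by apply: lt_le_trans vV'.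
have /andP[_ VG] := variance_bounded mu mq' q'G.
have Ggt0 : 0 < G.
  rewrite lt_neqAle G0 andbT; apply/eqP => GE.
  by move: VG; rewrite -GE expr0n/= -/V; lra.
(* With no subset of size [k] the maximal error is [0] by convention, so [e = 0] works surely. *)
have [C0|/set0Pn[S0 S0C]] := eqVneq C finset.set0.
  exists 0; split; first by rewrite divr_gt0.
  rewrite (_ : mkset _ = setT).
    rewrite [P _]probability_setT lee_fin; lra.
  by apply/seteqP; split => // w _ /=; rewrite C0 max_over_set0.
have K0 : (0 < #|C|)%N by apply/card_gt0P; exists S0.
have c0 : 0 < 512 :> R by rewrite ltr0n.
have [M0 tailM] := pick_freeze_sample_size K0 c0 Ggt0 v0 m0 theta0 eta01 hM.
rewrite ltr0n in M0.
have m1 : m <= 1.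
  have [S1 S1C [maxE _]] := max_overP TS S0C.
  have /andP[T0 T1] : 0 <= TS S1 <= 1.
    by rewrite TSE; exact: (closed_sobol_le1 mu_prod mq' q'G).
  (* At a maximizer, membership in [A] gives [m <= (1 - theta) * TS S1 <= 1], while non-membership
     would give [(1 - theta) * TS S1 <= - m < 0]. The bound on [m] is what makes [t <= V / 12]
     below. *)
  have [S1A|S1A] := boolP (S1 \in A).
    have := sepA _ S1A; rewrite /Tmax maxE.
    have : 0 <= theta * TS S1 by rewrite mulr_ge0// ltW.
    lra.
  have := sepCA S1; rewrite finset.in_setD S1A S1C /Tmax maxE => /(_ isT).
  have : theta * TS S1 <= TS S1 by rewrite ler_piMl// ltW.
  lra.
(* Chosen so that the score error [6 * t / V] is at most [m / (2 * (1 + theta))], half of the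
   admissible threshold; the half makes the inequality on [e] strict. *)
set t := m * vmin / (12 * (1 + theta)) in tailM.
have t0 : 0 < t by rewrite divr_gt0 ?mulr_gt0.
have tE : 6 * t = m / (2 * (1 + theta)) * vmin.
  by rewrite /t; clear -th1; field; lra.
have tV : t <= V / 12.
  rewrite /t ler_pdivrMr ?mulr_gt0//.
  have : m * vmin <= 1 * V by rewrite ler_pM// ltW.
  have : 0 <= theta * V by rewrite mulr_ge0// ltW.
  lra.
exists (m / (2 * (1 + theta))); split.
  rewrite ltr_pM2l// ltf_pV2 ?posrE ?mulr_gt0//; lra.
have [bad [mbad Pbad good]] := saltelli_concentration mu_prod mq' q'G rows M0 C
  V0 (introT andP (conj t0 tV)).
have [N [mN N0 sN]] := saltelli_ae_eq mu_prod qq' rows.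
set ev := mkset _.
have evE : ev = \bigcap_(S in [set` C])
    [set w | `|saltelli q (X ^~ w) (X' ^~ w) S - TS S| <=
             m / (2 * (1 + theta))].
  apply/seteqP; split => w /=.
    by move=> /(max_over_leP _ _ S0C) h S SC; exact: h.
  by move=> h; apply/(max_over_leP _ _ S0C) => S SC; exact: h.
have mev : measurable ev.
  rewrite evE; apply: fin_bigcap_measurable => // S _.
  rewrite -[X in measurable X]setTI; apply: measurable_fun_ler => //.
  apply: measurableT_comp => //; apply: measurable_funB => //.
  exact: measurable_saltelli.
(* Outside [bad] the clipped model has accurate scores, and outside the null set [N] its scores are
   those of [q]. Subadditivity then yields the probability bound. *)
have cover : setT `<=` ev `|` (bad `|` N).
  move=> w _; have [badw|nbad] := pselect (bad w); first by right; left.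
  have [Nw|nN] := pselect (N w); first by right; right.
  left; rewrite evE => S SC /=.
  have -> : saltelli q (X ^~ w) (X' ^~ w) S = saltelli q' (X ^~ w) (X' ^~ w) S.
    by apply: contrapT => ne; apply: nN; apply: sN => /(_ S).
  rewrite TSE; apply: le_trans (good w nbad S SC) _.
  rewrite ler_pdivrMr// tE.
  by rewrite ler_wpM2l// divr_ge0 ?mulr_ge0 ?ltW.
have mbN : measurable (bad `|` N) by exact: measurableU.
have Pbad_eta : (P bad <= eta%:E)%E by apply: le_trans Pbad _; rewrite lee_fin.
have Pcover : (1 <= P ev + eta%:E)%E.
  rewrite -(probability_setT P).
  apply: le_trans (le_measure P _ _ cover) _; rewrite ?inE//.
    exact: measurableU.
  apply: le_trans (measureU2 _ mev mbN) _; apply: leeD => //.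
  apply: le_trans (measureU2 _ mbad mN) _.
  rewrite -[leRHS]adde0; apply: leeD => //.
  by rewrite -N0.
by rewrite EFinB leeBlDr.
Qed.
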